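(* Let $X$ and $Z$ be Hausdorff spaces and $Y$ be a topological vector space such that $Z\subset X\subset Y'_{w^*}$, with continuous injections, where $Y'$ denotes the dual space of $Y$ and $Y'_{w^*}$ is $Y'$ endowed with the weak-star topology. Consider an interval $I\subset\mathbb{R}$ and a subset $\mathcal{U}\subset\mathcal{X}$, where $\mathcal{X}=\mathcal{C}_{\mathrm{loc}}(I,X)$. Let $\rho$ be a $\mathcal{U}$-trajectory statistical solution over $I$ and let $\mathcal{V}$ be a Borel subset of $\mathcal{X}$ such that $\mathcal{V}\subset\mathcal{U}$ and $\rho(\mathcal{V})=1$. Assume that $\mathfrak{B}_Z\subset\mathfrak{B}_X$; that $\mathcal{U}\subset\mathcal{X}_1$; and that $F:I\times Z\to Y'$ is an $(\mathfrak{L}_I\otimes\mathfrak{B}_Z,\mathfrak{B}_{Y'})$-measurable function such that, for every $u\in\mathcal{U}$, the function $t\mapsto F(t,u(t))$ is weak-star scalarwise locally integrable on $I$ and $$\frac{d}{dt}\langle u(t),v\rangle_{Y',Y}=\langle F(t,u(t)),v\rangle_{Y',Y}$$ in the distribution sense on $I$, for every $v\in Y$. Assume, moreover, that $$t\mapsto\int_{\mathcal{V}}\left|\langle F(t,u(t)),v\rangle_{Y',Y}\right|\,d\rho(u)\ \in L^1_{\mathrm{loc}}(I)$$ for every $v\in Y$. Then $$\int_{\mathcal{V}}\Phi(u(t))\,d\rho(u)=\int_{\mathcal{V}}\Phi(u(t'))\,d\rho(u)+\int_{t'}^t\int_{\mathcal{V}}\langle F(s,u(s)),\Phi'(u(s))\rangle_{Y',Y}\,d\rho(u)\,ds$$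 for all $t,t'\in I$ and for every cylindrical test function $\Phi$ in $Y'$. Moreover, the function $$t\mapsto\int_{\mathcal{V}}\varphi(u(t))\,d\rho(u)$$ is continuous on $I$ for every bounded continuous $\varphi:X\to\mathbb{R}$. In particular, the family of projections $\{\rho_t\}_{t\in I}$, where $\rho_t=\Pi_t\rho$, is a statistical solution in phase space of the equation $u_t=F(t,u)$ over the interval $I$.
   Context: $\mathfrak{B}_X$ denotes the Borel $\sigma$-algebra of a topological space $X$; $\mathfrak{L}_I$ the Lebesgue $\sigma$-algebra of the interval $I$. In $\mathfrak{B}_{Y'}$, the dual $Y'$, written without the subscript $w^*$, carries its usual (strong) dual topology, which is the operator-norm topology if $Y$ is a Banach space. Via the continuous injections, $Z$ is regarded as a subset of $X$ and $X$ as a subset of $Y'$; $\mathfrak{B}_Z\subset\mathfrak{B}_X$ means every Borel subset of $Z$ is a Borel subset of $X$. A measure is carried by a measurable set if the complement of the set is null. A nonnegative Borel measure $\mu$ is tight if $\mu(A)=\sup\{\mu(K):K\subset A\text{ compact}\}$ for all Borel $A$. $\mathcal{X}=\mathcal{C}_{\mathrm{loc}}(I,X)$ is the set of continuous functions $u:I\to X$ with the compact-open topology (subbase $\{u:u(J)\subset O\}$, $J\subset I$ compact subinterval, $O\subset X$ open). $\Pi_tu=u(t)$ and $\Pi_t\rho$ is the push-forward of $\rho$ by $\Pi_t$. A $\mathcal{U}$-trajectory statistical solution over $I$ is a tight Borel probability measure $\rho$ on $\mathcal{X}$ for which there is $\mathcal{V}\in\mathfrak{B}_{\mathcal{X}}$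 with $\mathcal{V}\subset\mathcal{U}$ and $\rho(\mathcal{X}\setminus\mathcal{V})=0$. A function $w:I\to Y'$ has a property weak-star scalarwise if $t\mapsto\langle w(t),v\rangle_{Y',Y}$ has the property for every $v\in Y$ (for locally integrable: Lebesgue integrable on compact subsets of $I$). ''Absolutely continuous on $I$'' means absolutely continuous on every compact subinterval of $I$. $\mathcal{Y}_1$ is the set of $u:I\to Y'$ that are weak-star scalarwise absolutely continuous and for which there is a weak-star scalarwise locally integrable $w:I\to Y'$ with $\frac{d}{dt}\langle u(t),v\rangle_{Y',Y}=\langle w(t),v\rangle_{Y',Y}$ for a.e. $t\in I$, for every $v\in Y$. Further, $\mathcal{Z}=\{u\in\mathcal{X}:u(t)\in Z\text{ for a.e. }t\in I\}$ and $\mathcal{X}_1=\mathcal{Z}\cap\mathcal{Y}_1$. For $u\in\mathcal{X}_1$, $F(t,u(t))$ is defined for a.e. $t$. Distributions on $I$ are tested against $\mathcal{C}^\infty_c(I)$, the smooth functions compactly supported in the interior of $I$. $L^1_{\mathrm{loc}}(I)$ means integrable on compact subsets of $I$. A cylindrical test function in $Y'$ is a function $\Phi(u)=\phi(\langle u,v_1\rangle_{Y',Y},\dots,\langle u,v_k\rangle_{Y',Y})$, $u\in Y'$, with $k\in\mathbb{N}$, $v_1,\dots,v_k\in Y$ and $\phi:\mathbb{R}^k\to\mathbb{R}$ continuously differentiable with compact support; its differential is $\Phi'(u)=\sum_{j=1}^k\partial_j\phi(\langle u,v_1\rangle_{Y',Y},\dots,\langle u,v_k\rangle_{Y',Y})\,v_j\in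 Y$. A statistical solution in phase space of $u_t=F(t,u)$ over $I$ is a family $\{\rho_t\}_{t\in I}$ of Borel probability measures on $X$ such that: (i) $t\mapsto\int_X\varphi\,d\rho_t$ is continuous on $I$ for every bounded continuous $\varphi:X\to\mathbb{R}$; (ii) for almost every $t\in I$, the measure $\rho_t$ is carried by $Z$ and the function $u\mapsto\langle F(t,u),v\rangle_{Y',Y}$ is $\rho_t$-integrable, for every $v\in Y$; moreover, the map $t\mapsto\int_X\langle F(t,u),v\rangle_{Y',Y}\,d\rho_t(u)$ belongs to $L^1_{\mathrm{loc}}(I)$, for every $v\in Y$; (iii) for every cylindrical test function $\Phi$ in $Y'$ and all $t,t'\in I$, $\int_X\Phi\,d\rho_t=\int_X\Phi\,d\rho_{t'}+\int_{t'}^t\int_X\langle F(s,u),\Phi'(u)\rangle_{Y',Y}\,d\rho_s(u)\,ds$. *)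

(* Defs.v *)
From HB Require Import structures.
From mathcomp Require Import all_boot all_order all_algebra.
From mathcomp Require Import all_classical all_reals all_analysis.
Set Implicit Arguments.
Unset Strict Implicit.
Unset Printing Implicit Defensive.
Import Order.TTheory GRing.Theory Num.Theory.
Import numFieldNormedType.Exports.
Local Open Scope classical_set_scope.
Local Open Scope ring_scope.

Notation borel T := (g_sigma_algebraType (open : set (set T))).

Section dual.
Context {R : realType} (Y : topologicalLmodType R).

Record dual := Dual {
  dual_fun :> Y -> R ;
  dual_linear : linear (dual_fun : Y -> R^o) ;
  dual_continuous : continuous dual_fun }.

HB.instance Definition _ := gen_eqMixin dual.
HB.instance Definition _ := gen_choiceMixin dual.

Fact dual0_linear : linear ((fun=> 0) : Y -> R^o).
Proof. by move=> a x y; rewrite scaler0 addr0. Qed.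

Definition dual0 : dual := Dual dual0_linear (fun x => cvg_cst (0 : R)).

HB.instance Definition _ := isPointed.Build dual dual0.

Definition weakstar_dual : Type :=
  initial_topology (fun w : dual => (w : {ptws Y -> R})).
HB.instance Definition _ := Topological.on weakstar_dual.

(* von Neumann boundedness *)
Definition tvs_bounded (B : set Y) : Prop :=
  forall U : set Y, nbhs 0 U ->
    exists2 r : R, 0 < r & forall s : R, r < s -> B `<=` ( *:%R s) @` U.

(* Topology of uniform convergence on the bounded subsets of Y; for a normed Y
   it is the topology of the operator norm. *)
Definition strong_dual : Type :=
  initial_topology (fun w : dual => (w : {family tvs_bounded, Y -> R})).
HB.instance Definition _ := Topological.on strong_dual.
HB.instance Definition _ := Pointed.on strong_dual.

End dual.

Section cylindrical.
Context {R : realType}.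

Definition partial_derivative k (phi : 'rV[R]_k -> R) (j : 'I_k)
  (x : 'rV[R]_k) : R := 'D_(delta_mx 0 j) phi x.

Definition continuously_differentiable k (phi : 'rV[R]_k -> R) : Prop :=
  (forall x, differentiable phi x) /\
  (forall j, continuous (partial_derivative phi j)).

Definition compactly_supported k (phi : 'rV[R]_k -> R) : Prop :=
  compact (closure [set x | phi x != 0]).

Record cylindrical (Y : topologicalLmodType R) := Cylindrical {
  cyl_dim : nat ;
  cyl_vec : 'I_cyl_dim -> Y ;
  cyl_profile : 'rV[R]_cyl_dim -> R ;
  cyl_profileC1 : continuously_differentiable cyl_profile ;
  cyl_profile_supp : compactly_supported cyl_profile }.

Context {Y : topologicalLmodType R} (Phi : cylindrical Y).

Definition cyl_coord (w : dual Y) : 'rV[R]_(cyl_dim Phi) :=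
  \row_j w (cyl_vec j).

Definition cyl_fun (w : dual Y) : R := cyl_profile (cyl_coord w).

Definition cyl_diff (w : dual Y) : Y :=
  \sum_(j < cyl_dim Phi)
    partial_derivative (@cyl_profile _ Phi) j (cyl_coord w) *: cyl_vec j.

End cylindrical.

(* The line with its Lebesgue sigma-algebra, the domain of
   completed_lebesgue_measure. *)
Notation lebesgue_line R := (caratheodory_type ((@wlength R idfun)^*)%mu).

(* A function on the set I has domain set_type I; 'valL_ 0 f is its extension
   by 0 to the whole line. *)

Section time.
Context {R : realType} (I : set R).

Notation leb := (@completed_lebesgue_measure R).

Definition ae_time (P : I -> Prop) : Prop :=
  leb.-negligible (val @` [set t : I | ~ P t]).

Definition L1loc (f : I -> \bar R) : Prop :=
  forall K : set R, compact K -> K `<=` I -> leb.-integrable K ('valL_ 0%E f).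

Definition oriented_integral (a b : I) (f : I -> \bar R) : \bar R :=
  (if (val a <= val b)%R then \int[leb]_(s in `[val a, val b]) 'valL_ 0%E f s
   else - \int[leb]_(s in `[val b, val a]) 'valL_ 0%E f s)%E.

Definition locally_abs_continuous (f : I -> R) : Prop :=
  forall c d : I, forall e : R, 0 < e -> exists2 delta : R, 0 < delta &
  forall (n : nat) (a b : 'I_n -> I),
    (forall i, [/\ val c <= val (a i), val (a i) <= val (b i)
                 & val (b i) <= val d]) ->
    trivIset setT (fun i => `]val (a i), val (b i)[%classic : set R) ->
    \sum_(i < n) (val (b i) - val (a i)) < delta ->
    \sum_(i < n) `|f (b i) - f (a i)| < e.

(* For almost every t, the point t is interior to I and the extension by 0 does
   not affect the derivative. *)
Definition ae_derivative (f g : I -> R) : Prop :=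
  ae_time (fun t => is_derive (val t : R) 1 ('valL_ 0 f : R -> R) (g t)).

Definition test_function (psi : R -> R) : Prop :=
  [/\ forall (n : nat) (t : R), derivable (psi^`(n))%classic t 1,
      compact (closure [set t | psi t != 0]) &
      closure [set t | psi t != 0] `<=` I°].

Definition distributional_derivative (f g : I -> R) : Prop :=
  forall psi, test_function psi ->
  \int[leb]_(t in I) ('valL_ 0 f t * derive1 psi t) =
  - \int[leb]_(t in I) ('valL_ 0 g t * psi t).

Context {Y : topologicalLmodType R}.

Definition scalarwise_L1loc (w : I -> dual Y) : Prop :=
  forall v : Y, L1loc (fun t => (w t v)%:E).

Definition scalarwise_abs_continuous (u : I -> dual Y) : Prop :=
  forall v : Y, locally_abs_continuous (fun t => u t v).

Definition Y1 : set (I -> dual Y) :=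
  [set u | scalarwise_abs_continuous u /\
    exists2 w : I -> dual Y, scalarwise_L1loc w &
      forall v : Y, ae_derivative (fun t => u t v) (fun t => w t v)].

End time.

Section trajectories.
Context {R : realType} (I : set R) (X : ptopologicalType).

Definition traj : Type := continuousType (set_type I) X.
HB.instance Definition _ := Choice.on traj.
HB.instance Definition _ := Topological.copy traj
  (initial_topology (fun u : continuousType (set_type I) X =>
     (u : {compact-open, set_type I -> X}))).

Definition traj_fun (u : traj) : set_type I -> X := Continuous.sort u.
Coercion traj_fun : traj >-> Funclass.

Fact cst_point_continuous : continuous (cst point : set_type I -> X).
Proof. exact: cst_continuous. Qed.

Definition traj0 : traj := Continuous.Pack
  (Continuous.Class (isContinuous.Build _ _ _ cst_point_continuous)).

HB.instance Definition _ := isPointed.Build traj traj0.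

Definition traj_eval (t : I) (u : borel traj) : borel X := (u : traj) t.

Fact traj_eval_continuous (t : I) : continuous (traj_eval t : traj -> X).
Proof.
apply/continuousP => O oO.
exists [set g : I -> X | g @` [set t] `<=` O].
  by apply: compact_open_open => //; exact: compact_set1.
by apply/seteqP; split => u /= => [|Ou _ [_ -> <-]//]; apply; exists t.
Qed.

Fact measurable_traj_eval (t : I) : measurable_fun setT (traj_eval t).
Proof.
apply: (@measurability _ _ (borel traj) (borel X) setT (traj_eval t)
  (open : set (set X))) => // _ [W oW <-].
rewrite setTI; apply: sub_sigma_algebra.
by have /continuousP := @traj_eval_continuous t; apply.
Qed.

HB.instance Definition _ (t : I) :=
  isMeasurableFun.Build _ _ _ _ (traj_eval t) (measurable_traj_eval t).

End trajectories.

Section statistical_solutions.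
Context {R : realType}.

Definition tight (T : ptopologicalType) (mu : set (borel T) -> \bar R) : Prop :=
  forall A : set (borel T), measurable A ->
  mu A = ereal_sup [set mu K | K in [set K : set T | compact K /\ K `<=` A]].

Definition carried_by d (T : measurableType d) (mu : set T -> \bar R)
  (A : set T) : Prop := measurable A /\ mu (~` A) = 0%E.

Context {Y : topologicalLmodType R} {X Z : ptopologicalType} (I : set R).

Definition trajectory_statistical_solution (U : set (traj I X))
    (rho : probability (borel (traj I X)) R) : Prop :=
  tight rho /\
  exists V : set (borel (traj I X)),
    [/\ measurable V, V `<=` U & rho (~` V) = 0%E].

Variables (iZX : Z -> X) (iXY : X -> dual Y).

Definition Zcal : set (traj I X) :=
  [set u | ae_time (fun t => range iZX (u t))].

Definition X1 : set (traj I X) := Zcal `&` [set u | Y1 (iXY \o u)].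

(* The extension by 0 to X of a function defined on the subset Z of X: F(t,u)
   is defined for u in Z only, and F(t,u(t)) for almost every t only. *)
Definition extZ (G : Z -> dual Y) (x : X) : dual Y :=
  if pselect (exists z, iZX z = x) is left h then G (sval (cid h))
  else dual0 Y.

Variable F : R -> Z -> dual Y.

Definition vfield (t : I) : X -> dual Y := extZ (F (val t)).

(* In the second item the null set of times may depend on v.
   In the third item the first component states that the double integral of the
   second one makes sense. *)
Definition phase_space_statistical_solution (r : I -> probability (borel X) R) :
    Prop :=
  [/\ forall phi : X -> R, continuous phi -> bounded_fun phi ->
        continuous (fun t : I => \int[r t]_x phi x),
      (forall v : Y, ae_time (fun t =>
         carried_by (r t) (range iZX) /\
         (r t).-integrable setT (fun x => (vfield t x v)%:E))) /\
      (forall v : Y, L1loc (fun t => \int[r t]_x (vfield t x v)%:E)%E) &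
      forall Phi : cylindrical Y,
        L1loc (fun s =>
          \int[r s]_x (vfield s x (cyl_diff Phi (iXY x)))%:E)%E /\
        forall t t' : I,
        (\int[r t]_x (cyl_fun Phi (iXY x))%:E =
         \int[r t']_x (cyl_fun Phi (iXY x))%:E +
         oriented_integral t' t (fun s =>
           \int[r s]_x (vfield s x (cyl_diff Phi (iXY x)))%:E))%E].

End statistical_solutions.

(* Main.v *)
(* Along a single trajectory, testing the distributional equation with smooth
   plateau functions whose edges shrink to the end points of [a, b] gives
   <u(b), v> - <u(a), v> = \int_a^b <F(s, u(s)), v> ds, also when a or b is an end
   point of I. A C^1 function of finitely many such pairings is then the integral
   of the expected derivative: by the mean value theorem the identity holds on
   short intervals up to a small multiple of the integral of the densities, and
   these errors add up. The equality is integrated over V by Fubini's theorem.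
   The joint measurability of (t, u) |-> u(t) comes from the compact-open
   topology, every set of pairs with u(t) in an open set being a countable union,
   indexed by rational segments, of rectangles with an open side. The joint
   measurability of (t, u) |-> F(t, u(t)) follows because the hypothesis on Borel
   sets of Z gives Z -> X a Borel left inverse. *)

Require Import Defs.
From HB Require Import structures.
From mathcomp Require Import all_boot all_order all_algebra.
From mathcomp Require Import all_classical all_reals all_analysis.
From mathcomp Require Import measurable_realfun lra.
Set Implicit Arguments.
Unset Strict Implicit.
Unset Printing Implicit Defensive.
Import Order.TTheory GRing.Theory Num.Theory.
Import numFieldNormedType.Exports.
Local Open Scope classical_set_scope.
Local Open Scope ring_scope.

(** * A smooth cutoff *)

(** Integrals in time are taken for the completed Lebesgue measure because [F] is Lebesgue
    measurable in time; the calculus of continuous functions is done with the Borel measure and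
    transferred. The obstacle in the cylindrical identity is that the direction [cyl_diff Phi] moves
    along the trajectory, while the hypotheses on [F] concern a fixed [v]. Expanding this direction
    over the finitely many [cyl_vec j] leaves fixed vectors, with coefficients that are continuous
    and, the profile having compact support, bounded; measurability and integrability then follow
    term by term. Two items of the phase space definition come from sections in the product of time
    and trajectories: the pairs (t, u) with u in V and u(t) outside Z have a null section at each
    fixed u, hence at almost every t, and integrability at almost every t is read off integrability
    over each compact segment. Continuity in time is dominated convergence along sequences of times,
    which suffice because I is metrizable. *)

Section cutoff.
Context {R : realType}.
Implicit Types f g : R -> R.

(** The order is finite so that stability under products and composition is an induction on [n]:
    their derivatives again involve the functions themselves, needed only to one order less. *)
Definition derivable_upto (n : nat) f :=
  forall k, (k < n)%N -> forall t, derivable (f^`(k))%classic t 1.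

Lemma derivable_upto0 f : derivable_upto 0 f.
Proof. by move=> k; rewrite ltn0. Qed.

Lemma derivable_upto_derive1 n f : (forall t, derivable f t 1) ->
  derivable_upto n f^`()%classic -> derivable_upto n.+1 f.
Proof.
by move=> f1 fn [_|k]; [rewrite derive1n0 | rewrite ltnS derive1Sn; exact: fn].
Qed.

Lemma derivable_upto1 n f : derivable_upto n.+1 f ->
  forall t, derivable f t 1.
Proof. by move=> /(_ 0%N isT); rewrite derive1n0. Qed.

Lemma derivable_uptoS n f : derivable_upto n.+1 f ->
  derivable_upto n f^`()%classic.
Proof. by move=> fn k kn; rewrite -derive1Sn; exact: fn. Qed.

Lemma derivable_uptoW n f : derivable_upto n.+1 f -> derivable_upto n f.
Proof. by move=> fn k kn; apply: fn; rewrite ltnS ltnW. Qed.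

Lemma derivable_upto_cst n (c : R) : derivable_upto n (cst c).
Proof.
elim: n c => [|n IH] c; first exact: derivable_upto0.
apply: derivable_upto_derive1 => //.
rewrite [X in derivable_upto _ X](_ : _ = cst 0) //.
by apply/funext => t; rewrite derive1_cst.
Qed.

Lemma derivable_uptoD n f g : derivable_upto n f -> derivable_upto n g ->
  derivable_upto n (f \+ g).
Proof.
elim: n f g => [|n IH] f g fn gn; first exact: derivable_upto0.
have f1 := derivable_upto1 fn; have g1 := derivable_upto1 gn.
apply: derivable_upto_derive1 => [t|]; first exact: derivableD.
rewrite [X in derivable_upto _ X](_ : _ = f^`()%classic \+ g^`()%classic).
  by apply: IH; exact: derivable_uptoS.
by apply/funext => t; rewrite /= !derive1E deriveD.
Qed.

Lemma derivable_uptoM n f g : derivable_upto n f -> derivable_upto n g ->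
  derivable_upto n (f \* g).
Proof.
elim: n f g => [|n IH] f g fn gn; first exact: derivable_upto0.
have f1 := derivable_upto1 fn; have g1 := derivable_upto1 gn.
apply: derivable_upto_derive1 => [t|]; first exact: derivableM.
rewrite [X in derivable_upto _ X](_ : _ =
    (f \* g^`()%classic) \+ (g \* f^`()%classic)).
  by apply: derivable_uptoD; apply: IH;
    [exact: derivable_uptoW|exact: derivable_uptoS..|exact: derivable_uptoW|
     exact: derivable_uptoS].
by apply/funext => t; rewrite /= !derive1E deriveM.
Qed.

Lemma derivable_upto_id n : derivable_upto n (id : R -> R).
Proof.
case: n => [|n]; first exact: derivable_upto0.
apply: derivable_upto_derive1 => //.
rewrite [X in derivable_upto _ X](_ : _ = cst 1); first exact: derivable_upto_cst.
by apply/funext => t; rewrite derive1_id.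
Qed.

Lemma derivable_upto_comp n f g : derivable_upto n f -> derivable_upto n g ->
  derivable_upto n (f \o g).
Proof.
elim: n f g => [|n IH] f g fn gn; first exact: derivable_upto0.
have f1 := derivable_upto1 fn; have g1 := derivable_upto1 gn.
apply: derivable_upto_derive1 => [t|].
  have fgt : is_derive (g t) 1 f (f^`()%classic (g t)).
    by apply: DeriveDef => //; rewrite derive1E.
  have gt : is_derive t 1 g (g^`()%classic t).
    by apply: DeriveDef => //; rewrite derive1E.
  by have [] := is_derive1_comp fgt gt.
rewrite [X in derivable_upto _ X](_ : _ =
    (f^`()%classic \o g) \* g^`()%classic).
  apply: derivable_uptoM; last exact: derivable_uptoS.
  by apply: IH; [exact: derivable_uptoS|exact: derivable_uptoW].
by apply/funext => t; rewrite /= derive1_comp.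
Qed.

(* The family is stable under differentiation up to linear combinations, which
   makes smoothness an induction, see [is_derive_flat]. *)
Definition flat (m : nat) (x : R) : R :=
  if 0 < x then x ^- m * expR (- x^-1) else 0.

Lemma flat_ge0 m x : 0 <= flat m x.
Proof.
rewrite /flat; case: ifPn => // x0.
by rewrite mulr_ge0 ?expR_ge0// invr_ge0 exprn_ge0// ltW.
Qed.

(** The exponential series gives exp(1/x) >= x^-(m+2) / (m+2)!. The two extra powers of x are what
    makes the difference quotient at 0 tend to 0. *)
Lemma flat_le m x : flat m x <= m.+2`!%:R * x ^+ 2.
Proof.
rewrite /flat; case: ifPn => [x0|_]; last by rewrite mulr_ge0 ?sqr_ge0.
have := @expR_ge1Dxn _ x^-1 m.+1 (ltW _); rewrite invr_gt0 => /(_ x0) /= h.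
have h1 : x ^- m.+2 / m.+2`!%:R <= expR x^-1.
  by rewrite -exprVn (le_trans _ h)// lerDr.
rewrite expRN ler_pdivrMr ?expR_gt0//.
have f0 : (0 : R) < m.+2`!%:R by rewrite ltr0n fact_gt0.
rewrite ler_pdivrMr// in h1.
have -> : x ^- m = x ^- m.+2 * x ^+ 2.
  by rewrite -[m.+2]addn2 exprD invfM -mulrA mulVf ?mulr1// expf_neq0// gt_eqF.
rewrite [leRHS]mulrAC ler_wpM2r ?sqr_ge0// (le_trans h1)//.
by rewrite mulrC.
Qed.

(** On x > 0 this is the product rule for x^-m exp(-1/x), and on x < 0 the function is locally 0. At
    0, [flat_le] bounds the difference quotient by (m+2)! |h|. *)
Lemma is_derive_flat m (x : R) :
  is_derive x (1 : R) (flat m) (flat m.+2 x - m%:R * flat m.+1 x).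
Proof.
have [x0|x0|x0] := ltgtP 0 x.
- have xN0 : x != 0 by rewrite gt_eqF.
  have dV : is_derive x (1 : R) (fun y : R => y^-1) (- x ^- 2).
    have := @is_deriveV R id x 1 1 xN0 (is_derive_id _ _).
    by rewrite /GRing.scale/= mulr1.
  have dX := is_deriveX m dV.
  have dE : is_derive x (1 : R) (expR \o (fun y : R => - y^-1))
      (expR (- x^-1) * x ^- 2).
    apply: is_derive1_comp.
    rewrite -[x ^- 2]opprK; exact: is_deriveN.
  have dM := is_deriveM dX dE.
  apply: (@near_eq_is_derive R R R
      ((fun y : R => y^-1) ^+ m * (expR \o (fun y : R => - y^-1)))).
    near=> y; have y0 : 0 < y by near: y; exact: lt_nbhsr.
    by rewrite /flat y0 /= fctE /= exprfctE exprVn.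
  apply: (is_derive_eq dM).
  rewrite /flat x0 /GRing.scale/= exprfctE -!exprVn.
  set y := x^-1; set e := expR _.
  case: m {dX dM} => [|m] /=.
    by rewrite !mul0r subr0 !expr0 mulr0 addr0; lra.
  rewrite !exprS; lra.
- apply: (@near_eq_is_derive R R R (cst 0)).
    near=> y; have y0 : y < 0 by near: y; exact: lt_nbhsl.
    by rewrite /flat ltNge ltW.
  rewrite /flat ltNge (ltW x0) /= mulr0 subr0; exact: is_derive_cst.
- rewrite -x0 /flat ltxx mulr0 subr0.
  suff h : (fun h : R => h^-1 *: (flat m (h *: 1 + 0) - flat m 0)) h @[h --> 0^'] --> (0:R).
    apply: DeriveDef; first by apply/cvg_ex; exists 0.
    exact: cvg_lim h.
  have -> : flat m 0 = 0 by rewrite /flat ltxx.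
  have k : m.+2`!%:R * `|h| @[h --> (0 : R)^'] --> (0 : R).
    apply: cvg_within_filter.
    have : m.+2`!%:R * `|h| @[h --> (0 : R)] --> m.+2`!%:R * `|0 : R|.
      by apply: cvgMr; exact: (@cvg_norm _ R).
    by rewrite normr0 mulr0.
  apply: norm_cvg0.
  apply: (@squeeze_cvgr _ _ _ _ (cst 0) (fun h => m.+2`!%:R * `|h|)) => //.
    near=> h; rewrite normr_ge0 /=.
    have h0 : h != 0 by near: h; exact: nbhs_dnbhs_neq.
    rewrite addr0 subr0 /GRing.scale/= mulr1 normrM normfV.
    rewrite ler_pdivrMl ?normr_gt0// (ger0_norm (flat_ge0 _ _)).
    by rewrite (le_trans (flat_le m h))// -(real_normK (num_real h)) expr2 mulrCA.
  exact: cvg_cst.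
Unshelve. all: by end_near. Qed.

Lemma derivable_upto_flat n m : derivable_upto n (flat m).
Proof.
elim: n m => [|n IH] m; first exact: derivable_upto0.
apply: derivable_upto_derive1 => [t|]; first by have [] := is_derive_flat m t.
rewrite [X in derivable_upto _ X](_ : _ =
    flat m.+2 \+ (cst (- m%:R) \* flat m.+1)).
  by apply: derivable_uptoD => //; apply: derivable_uptoM => //;
    exact: derivable_upto_cst.
apply/funext => t; rewrite derive1E.
by have [_ ->] := is_derive_flat m t; rewrite /= mulNr.
Qed.

Lemma flat_eq0 m x : x <= 0 -> flat m x = 0.
Proof. by rewrite /flat leNgt => /negbTE ->. Qed.

Lemma flat0_le1 x : flat 0 x <= 1.
Proof.
rewrite /flat; case: ifPn => // x0.
by rewrite expr0 invr1 mul1r expR_le1 oppr_le0 invr_ge0 ltW.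
Qed.

Lemma flat_continuous m : continuous (flat m).
Proof.
move=> x; apply: differentiable_continuous; apply/derivable1_diffP.
by have [] := is_derive_flat m x.
Qed.

(* Vanishes for x <= 0 and is a positive constant, not normalized to 1, for
   x >= 1. *)
Definition cutoff (x : R) : R := flat 0 (expR (- 1) - flat 0 (1 - x)).

(** The derivative of [cutoff]: at [m = 0], [is_derive_flat] makes [flat 2] the derivative of
    [flat 0], and the two minus signs of the chain rule cancel. *)
Definition cutoff' (x : R) : R :=
  flat 2 (expR (- 1) - flat 0 (1 - x)) * flat 2 (1 - x).

Lemma is_derive_cutoff (x : R) : is_derive x (1 : R) cutoff (cutoff' x).
Proof.
have d1 : is_derive x (1 : R) (fun y => 1 - y) (- 1).
  rewrite -[X in is_derive _ _ _ X]add0r.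
  by apply: is_deriveD.
have d2 : is_derive x (1 : R) (fun y => expR (- 1) - flat 0 (1 - y))
    (flat 2 (1 - x)).
  rewrite -[X in is_derive _ _ _ X]add0r; apply: is_deriveD.
  rewrite -[X in is_derive _ _ _ X]opprK; apply: is_deriveN.
  rewrite -mulrN1; apply: (@is_derive1_comp _ (flat 0)) => //.
  by have := is_derive_flat 0 (1 - x); rewrite mul0r subr0.
apply: (@is_derive1_comp _ (flat 0)) => //.
by have := is_derive_flat 0 (expR (- 1) - flat 0 (1 - x)); rewrite mul0r subr0.
Qed.

Lemma derivable_upto_cutoff n : derivable_upto n cutoff.
Proof.
have affine f : derivable_upto n f -> forall c : R, derivable_upto n (fun x => c - f x).
  move=> fn c; rewrite [X in derivable_upto _ X](_ : _ =
     cst c \+ (cst (-1) \* f)); last by apply/funext => t /=; rewrite mulN1r.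
  apply: derivable_uptoD; first exact: derivable_upto_cst.
  by apply: derivable_uptoM => //; exact: derivable_upto_cst.
apply: (@derivable_upto_comp n (flat 0)); first exact: derivable_upto_flat.
apply: (affine); apply: (@derivable_upto_comp n (flat 0)).
  exact: derivable_upto_flat.
by apply: affine; exact: derivable_upto_id.
Qed.

(** The constant exp(-1) is [flat 0 1], chosen so that the inner difference of [cutoff] changes sign
    exactly at 0: for x <= 0 one has 1 - x >= 1, where [flat 0] is at least exp(-1). *)
Lemma cutoff_arg_le0 x : x <= 0 -> expR (- 1) - flat 0 (1 - x) <= 0.
Proof.
move=> x0; have h : 1 <= 1 - x by rewrite lerDl oppr_ge0.
rewrite subr_le0 /flat (lt_le_trans _ h)// expr0 invr1 mul1r ler_expR.
by rewrite lerN2 invf_le1// (lt_le_trans _ h).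
Qed.

Lemma cutoff0 x : x <= 0 -> cutoff x = 0.
Proof. by move=> /cutoff_arg_le0 x0; rewrite /cutoff flat_eq0. Qed.

Lemma cutoff1 x : 1 <= x -> cutoff x = cutoff 1.
Proof. by move=> x1; rewrite /cutoff subrr (@flat_eq0 0 (1 - x)) ?subr_le0//
  (@flat_eq0 0 0). Qed.

Lemma cutoff1_gt0 : 0 < cutoff 1.
Proof.
rewrite /cutoff subrr (@flat_eq0 0 0)// subr0 /flat expR_gt0 expr0 invr1 mul1r.
exact: expR_gt0.
Qed.

Lemma cutoff_ge0 x : 0 <= cutoff x. Proof. exact: flat_ge0. Qed.

Lemma cutoff_le1 x : cutoff x <= 1. Proof. exact: flat0_le1. Qed.

Lemma cutoff'_eq0 x : ~~ (0 < x < 1) -> cutoff' x = 0.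
Proof.
rewrite negb_and -!leNgt => /orP[/cutoff_arg_le0 x0|x1]; rewrite /cutoff'.
  by rewrite flat_eq0 ?mul0r.
by rewrite [X in _ * X]flat_eq0 ?mulr0// subr_le0.
Qed.

(** Each factor [flat 2] is taken at an argument at most 1, where [flat_le] with [m = 2] bounds it
    by 4!. *)
Lemma cutoff'_bounded x : `|cutoff' x| <= 4`!%:R * 4`!%:R.
Proof.
have [/andP[x0 x1]|/cutoff'_eq0 ->] := boolP (0 < x < 1); last first.
  by rewrite normr0 mulr_ge0.
have flat2 y : y <= 1 -> flat 2 y <= 4`!%:R.
  move=> y1; have [y0|y0] := leP y 0; first by rewrite flat_eq0.
  by rewrite (le_trans (flat_le _ _))// ler_piMr// expr_le1// ltW.
rewrite ger0_norm ?mulr_ge0 ?flat_ge0//.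
rewrite ler_pM ?flat_ge0// flat2//; last by rewrite gerBl ltW.
by rewrite (le_trans (_ : _ <= expR (-1)))// ?gerBl ?flat_ge0// expR_le1 oppr_le0.
Qed.

Lemma cutoff'_continuous : continuous cutoff'.
Proof.
have c1 : continuous (fun x : R => 1 - x).
  by move=> x; apply: cvgB => //; exact: cvg_cst.
have c2 m : continuous (fun x : R => flat m (1 - x)).
  move=> x; exact: (@continuous_comp _ _ _ (fun x : R => 1 - x) (flat m) x
    (c1 x) (@flat_continuous m _)).
move=> x; apply: cvgM; last exact: c2.
have c3 : {for x, continuous (fun x : R => expR (-1) - flat 0 (1 - x))}.
  by apply: cvgB; [exact: cvg_cst|exact: c2].
exact: (@continuous_comp _ _ _ _ (flat 2) x c3 (@flat_continuous 2 _)).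
Qed.

End cutoff.

(** * The fundamental theorem for distributional derivatives *)

Section lebesgue_line.
Context {R : realType}.
Notation leb := (@completed_lebesgue_measure R).
Notation mu := (@lebesgue_measure R).

Lemma measurable_lebesgue_line (A : set R) :
  measurable A ->
  measurable (A : set (lebesgue_line R)).
Proof. exact: sub_caratheodory. Qed.

Lemma measurable_id_lebesgue_line :
  measurable_fun setT (id : lebesgue_line R -> measurableTypeR R).
Proof. by move=> _ B mB; rewrite setTI; exact: measurable_lebesgue_line. Qed.

Lemma measurable_fun_lebesgue_line d (T : measurableType d)
    (D : set R) (f : R -> T) : measurable D ->
  measurable_fun D f ->
  measurable_fun (D : set (lebesgue_line R)) (f : lebesgue_line R -> T).
Proof. by move=> mD mf _ B mB; apply: measurable_lebesgue_line; exact: mf. Qed.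

(** The identity from the Lebesgue line to the Borel line is measurable and pushes the completed
    measure forward to the Borel one, so this is a change of variables, applied to the positive and
    negative parts. *)
Lemma integral_lebesgue_line (D : set R) (f : R -> \bar R) :
  measurable D ->
  measurable_fun D f ->
  (\int[leb]_(x in D) f x = \int[mu]_(x in D) f x)%E.
Proof.
move=> mD mf.
have ge0 (h : R -> \bar R) :
    measurable_fun D h -> (forall x, 0 <= h x)%E ->
    (\int[leb]_(x in D) h x = \int[mu]_(x in D) h x)%E.
  move=> mh h0.
  have := @ge0_integral_pushforward _ _ _ _ _ _ measurable_id_lebesgue_line
    leb D h mD mh (fun x _ => h0 x).
  move=> /esym E; rewrite [LHS]E.
  have E2 := @eq_measure_integral _ (measurableTypeR R) R D mu
    (pushforward leb (id : lebesgue_line R -> measurableTypeR R)) h.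
  exact: (E2 measurable_id_lebesgue_line (fun A _ _ => erefl)).
rewrite integralE [in RHS]integralE !ge0//.
- exact: measurable_funeneg.
- exact: measurable_funepos.
Qed.

Lemma integrable_lebesgue_line (D : set R) (f : R -> \bar R) :
  measurable D ->
  mu.-integrable D f -> leb.-integrable D f.
Proof.
move=> mD /integrableP[mf fi]; apply/integrableP; split.
  exact: measurable_fun_lebesgue_line.
rewrite integral_lebesgue_line//; exact: measurableT_comp.
Qed.

Lemma Rintegral_lebesgue_line (D : set R) (f : R -> R) :
  measurable D ->
  measurable_fun D f ->
  \int[leb]_(x in D) f x = \int[mu]_(x in D) f x.
Proof.
move=> mD mf; congr fine; apply: integral_lebesgue_line => //.
exact/measurable_EFinP.
Qed.

Lemma lebesgue_line_set1 (x : R) : leb [set x] = 0%E.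
Proof. exact: (@lebesgue_measure_set1 R). Qed.

Lemma segment_lebesgue_line (a b : R) :
  measurable (`[a, b]%classic : set (lebesgue_line R)).
Proof. exact: measurable_lebesgue_line. Qed.

End lebesgue_line.

Section distribution.
Context {R : realType}.
Notation leb := (@completed_lebesgue_measure R).
Notation mu := (@lebesgue_measure R).
Let M : R := 4`!%:R * 4`!%:R.

(** A smooth step that rises from 0 to [cutoff 1] on [p, p + 1/l]. *)
Definition scaled_cutoff (l p t : R) : R := cutoff (l * (t - p)).

Definition scaled_cutoff' (l p t : R) : R := l * cutoff' (l * (t - p)).

Lemma is_derive_scaled_cutoff (l p t : R) :
  is_derive t (1 : R) (scaled_cutoff l p) (scaled_cutoff' l p t).
Proof.
have d1 : is_derive t (1 : R) (fun y => l * (y - p)) l.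
  rewrite -[X in is_derive _ _ _ X](mulr1 l); apply: is_deriveZ.
  rewrite -[X in is_derive _ _ _ X](subr0 1); apply: is_deriveB.
rewrite /scaled_cutoff' mulrC.
exact: (@is_derive1_comp _ cutoff _ _ _ _ (is_derive_cutoff _)).
Qed.

Lemma derive1_scaled_cutoff (l p : R) :
  (scaled_cutoff l p)^`()%classic = scaled_cutoff' l p.
Proof.
by apply/funext => t; rewrite derive1E; have [_ ->] := is_derive_scaled_cutoff l p t.
Qed.

Lemma derivable_upto_scaled_cutoff n l p : derivable_upto n (scaled_cutoff l p).
Proof.
rewrite [X in derivable_upto _ X](_ : _ =
  cutoff \o (cst l \* (id \+ cst (- p)))) //.
apply: derivable_upto_comp; first exact: derivable_upto_cutoff.
apply: derivable_uptoM; first exact: derivable_upto_cst.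
apply: derivable_uptoD; first exact: derivable_upto_id.
exact: derivable_upto_cst.
Qed.

Lemma scaled_cutoff'_continuous l p : continuous (scaled_cutoff' l p).
Proof.
have c1 : continuous (fun t : R => l * (t - p)).
  by move=> t; apply: cvgMr; apply: cvgB => //; exact: cvg_cst.
move=> t; apply: cvgMr.
exact: (@continuous_comp _ _ _ _ cutoff' t (c1 t) (@cutoff'_continuous R _)).
Qed.

Lemma scaled_cutoff_le (l p t : R) : 0 < l -> t <= p -> scaled_cutoff l p t = 0.
Proof.
by move=> l0 tp; rewrite /scaled_cutoff cutoff0// pmulr_rle0// subr_le0.
Qed.

Lemma scaled_cutoff_ge (l p t : R) : 0 < l -> p + l^-1 <= t ->
  scaled_cutoff l p t = cutoff 1.
Proof.
move=> l0 tp; rewrite /scaled_cutoff cutoff1//.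
by rewrite -ler_pdivrMl// mulr1 lerBrDl.
Qed.

Lemma scaled_cutoff'_eq0 (l p t : R) : 0 < l -> ~~ (p < t < p + l^-1) ->
  scaled_cutoff' l p t = 0.
Proof.
move=> l0 h; rewrite /scaled_cutoff' cutoff'_eq0 ?mulr0//.
apply: contra h => /andP[]; rewrite pmulr_rgt0// subr_gt0 => -> /=.
by rewrite -ltr_pdivlMl// mulr1 ltrBlDl.
Qed.

Lemma scaled_cutoff'_bounded (l p t : R) : 0 < l -> `|scaled_cutoff' l p t| <= l * M.
Proof.
by move=> l0; rewrite normrM gtr0_norm// ler_pM2l// cutoff'_bounded.
Qed.

Lemma integral_scaled_cutoff' (l p : R) : 0 < l ->
  \int[mu]_(t in `[p, p + l^-1]) scaled_cutoff' l p t = cutoff 1.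
Proof.
move=> l0; have pq : p < p + l^-1 by rewrite ltrDl invr_gt0.
have cK : continuous (scaled_cutoff l p).
  move=> t; apply: differentiable_continuous; apply/derivable1_diffP.
  by have [] := is_derive_scaled_cutoff l p t.
rewrite /Rintegral (@continuous_FTC2 _ _ (scaled_cutoff l p))//.
- by rewrite scaled_cutoff_ge// scaled_cutoff_le//= subr0.
- apply: continuous_subspaceT; exact: scaled_cutoff'_continuous.
- split.
  + by move=> t _; have [] := is_derive_scaled_cutoff l p t.
  + apply: cvg_at_right_filter; exact: cK.
  + apply: cvg_at_left_filter; exact: cK.
- by move=> t _; rewrite derive1_scaled_cutoff.
Qed.

(* The derivative of the cutoff has mass [cutoff 1], concentrated on
   [p, p + 1/l]. *)
Lemma approximate_identity (a b l p y e : R) (f : R -> R) : 0 < l ->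
  a <= p -> p + l^-1 <= b -> {within `[a, b], continuous f} ->
  (forall t, p <= t <= p + l^-1 -> `|f t - y| <= e) ->
  `|\int[leb]_(t in `[a, b]) (f t * scaled_cutoff' l p t) - cutoff 1 * y|
    <= e * M.
Proof.
move=> l0 ap qb cf fy; set q := p + l^-1.
have pq : p < q by rewrite ltrDl invr_gt0.
have sub : `[p, q] `<=` `[a, b].
  by move=> t /=; rewrite !in_itv/= => /andP[pt tq]; rewrite (le_trans ap)// (le_trans tq).
have cf' : {within `[p, q], continuous f} by apply: continuous_subspaceW cf.
have ck A : {within A, continuous (scaled_cutoff' l p)}.
  apply: continuous_subspaceT; exact: scaled_cutoff'_continuous.
have int_ (h : R -> R) : {within `[p, q], continuous h} ->
    mu.-integrable `[p, q] (EFin \o h).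
  by move=> ch; apply: continuous_compact_integrable => //; exact: segment_compact.
rewrite Rintegral_lebesgue_line//; last first.
  apply: subspace_continuous_measurable_fun => // t.
  by apply: cvgM; [exact: cf|exact: ck].
have -> : \int[mu]_(t in `[a, b]) (f t * scaled_cutoff' l p t) =
          \int[mu]_(t in `[p, q]) (f t * scaled_cutoff' l p t).
  rewrite Rintegral_mkcond [RHS]Rintegral_mkcond; congr (Rintegral _ _ _).
  apply/funext => t; rewrite /patch; case: ifPn => [/set_mem tab|tab].
    case: ifPn => // tpq; rewrite scaled_cutoff'_eq0 ?mulr0//.
    apply: contra tpq => /andP[pt tq]; apply/mem_set => /=.
    by rewrite in_itv/= !ltW.
  case: ifPn => // /set_mem/sub tab'; by rewrite mem_set in tab.
have -> : cutoff 1 * y = \int[mu]_(t in `[p, q]) (scaled_cutoff' l p t * y).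
  rewrite RintegralZr//; last by apply: int_; exact: ck.
  by rewrite integral_scaled_cutoff'.
rewrite -RintegralB//; last first.
- by apply: int_ => t; apply: cvgM; [exact: ck|exact: cvg_cst].
- by apply: int_ => t; apply: cvgM; [exact: cf'|exact: ck].
have ci : {within `[p, q], continuous
    (fun t => f t * scaled_cutoff' l p t - scaled_cutoff' l p t * y)}.
  move=> t; apply: cvgB; apply: cvgM; [exact: cf'|exact: ck|exact: ck|exact: cvg_cst].
apply: (le_trans (le_normr_Rintegral _ (int_ _ ci))) => //.
apply: (@le_trans _ _ (\int[mu]_(t in `[p, q]) (e * (l * M)))).
  apply: le_Rintegral => //.
  - apply: int_ => t; apply: (@cvg_norm _ R); exact: ci.
  - by apply: int_ => t; exact: cvg_cst.
  - move=> t; rewrite /= in_itv/= => tpq.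
    rewrite mulrC -mulrBr mulrC normrM ler_pM// ?fy//.
    exact: scaled_cutoff'_bounded.
have -> : \int[mu]_(t in `[p, q]) (e * (l * M)) =
    e * (l * M) * fine (mu `[p, q]) by exact: Rintegral_cst.
rewrite lebesgue_measure_itv/= lte_fin pq/= addrAC subrr add0r.
by rewrite -mulrA [l * M]mulrC -mulrA divff ?mulr1// gt_eqF.
Qed.

(* The steps are placed so that the support stays inside the open interval
   ]a, b[, while the function still equals [cutoff 1] on most of it. *)
Definition plateau (a b l t : R) : R :=
  scaled_cutoff l (a + l^-1) t - scaled_cutoff l (b - 2 * l^-1) t.

(** The steps rise on [a + 1/l, a + 2/l] and on [b - 2/l, b - 1/l], and the condition on [l] keeps
    the second from starting before a + 1/l and the first from ending after b - 1/l. To the left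
    both steps vanish; to the right both equal [cutoff 1] and cancel. *)
Lemma plateau_out (a b l t : R) : 0 < l -> a + 3 * l^-1 <= b ->
  ~~ (a + l^-1 < t < b - l^-1) -> plateau a b l t = 0.
Proof.
move=> l0 lab; have li : 0 < l^-1 by rewrite invr_gt0.
rewrite negb_and -!leNgt => /orP[ta|tb]; rewrite /plateau.
  by rewrite !scaled_cutoff_le ?subrr//; lra.
by rewrite !scaled_cutoff_ge ?subrr//; lra.
Qed.

Lemma plateau_in (a b l t : R) : 0 < l ->
  a + 2 * l^-1 <= t <= b - 2 * l^-1 -> plateau a b l t = cutoff 1.
Proof.
move=> l0 /andP[at_ tb]; rewrite /plateau scaled_cutoff_ge//; last lra.
by rewrite scaled_cutoff_le// subr0.
Qed.

Lemma plateau_bounded (a b l t : R) : `|plateau a b l t| <= 2.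
Proof.
rewrite /plateau /scaled_cutoff; set x := l * _; set y := l * _.
rewrite (le_trans (ler_normB _ _))// !ger0_norm ?cutoff_ge0//.
by have := cutoff_le1 x; have := cutoff_le1 y; lra.
Qed.

Lemma is_derive_plateau (a b l t : R) : is_derive t (1 : R) (plateau a b l)
  (scaled_cutoff' l (a + l^-1) t - scaled_cutoff' l (b - 2 * l^-1) t).
Proof. by apply: is_deriveB; exact: is_derive_scaled_cutoff. Qed.

Lemma plateau_supp (a b l : R) : 0 < l -> a + 3 * l^-1 <= b ->
  closure [set t | plateau a b l t != 0] `<=` `[a + l^-1, b - l^-1].
Proof.
move=> l0 lab; rewrite closureE => t; apply; split; first exact: interval_closed.
move=> s /= s0; rewrite in_itv/=; apply: contraNT s0 => h.
rewrite plateau_out//; apply: contra h => /andP[h1 h2]; by rewrite !ltW.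
Qed.

Lemma test_function_plateau (I : set R) (a b l : R) : 0 < l ->
  a + 3 * l^-1 <= b -> `[a, b] `<=` I -> test_function I (plateau a b l).
Proof.
move=> l0 lab abI; have li : 0 < l^-1 by rewrite invr_gt0.
split.
- move=> n t; have : derivable_upto n.+1 (plateau a b l).
    rewrite [X in derivable_upto _ X](_ : _ = scaled_cutoff l (a + l^-1) \+
      (cst (-1) \* scaled_cutoff l (b - 2 * l^-1))).
      apply: derivable_uptoD; first exact: derivable_upto_scaled_cutoff.
      apply: derivable_uptoM; first exact: derivable_upto_cst.
      exact: derivable_upto_scaled_cutoff.
    by apply/funext => s /=; rewrite mulN1r.
  by apply.
- apply: (@subclosed_compact _ _ `[a + l^-1, b - l^-1]).
  + exact: closed_closure.
  + exact: segment_compact.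
  + exact: plateau_supp.
- apply: (subset_trans (plateau_supp l0 lab)).
  apply: (@subset_trans _ `]a, b[).
    move=> t /=; rewrite !in_itv/= => /andP[h1 h2]; apply/andP; split; lra.
  rewrite -open_subsetE; last exact: interval_open.
  by apply: (subset_trans _ abI); exact: subset_itv_oo_cc.
Qed.

Lemma near_plateau (a b t : R) : a < t < b ->
  \forall n \near \oo, plateau a b n.+1%:R t = cutoff 1.
Proof.
move=> /andP[at_ tb].
have e0 : 0 < Order.min (t - a) (b - t) / 2.
  by rewrite divr_gt0// lt_min !subr_gt0 at_ tb.
near=> n; apply: plateau_in => //.
have : n.+1%:R^-1 < Order.min (t - a) (b - t) / 2.
  by near: n; exact: near_infty_natSinv_lt (PosNum e0).
move: n.+1%:R^-1 => m.
by rewrite ltr_pdivlMr// lt_min => /andP[? ?]; apply/andP; split; lra.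
Unshelve. all: by end_near. Qed.

(** Dominated convergence under 2|g|: at each point of ]a, b[ the plateau eventually equals
    [cutoff 1], and the two end points form a null set. *)
Lemma integral_plateau_cvg (a b : R) (g : R -> R) : a < b ->
  leb.-integrable `[a, b] (EFin \o g) ->
  \int[leb]_(t in `[a, b]) (g t * plateau a b n.+1%:R t) @[n --> \oo] -->
  cutoff 1 * \int[leb]_(t in `[a, b]) g t.
Proof.
move=> ab ig.
have mab := segment_lebesgue_line a b.
have mp n : measurable_fun (`[a, b]%classic : set (lebesgue_line R))
    (plateau a b n.+1%:R : lebesgue_line R -> R).
  apply: measurable_fun_lebesgue_line => //.
  apply: subspace_continuous_measurable_fun => //.
  apply: continuous_subspaceT => t; apply: differentiable_continuous.
  apply/derivable1_diffP.
  by have [] := is_derive_plateau a b n.+1%:R t.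
have m1 (x : R) : measurable ([set x] : set (lebesgue_line R)).
  by apply: measurable_lebesgue_line; exact: measurable_set1.
have mg : measurable_fun (`[a, b]%classic : set (lebesgue_line R)) (g : lebesgue_line R -> R).
  by apply/measurable_EFinP; exact: measurable_int ig.
have mf n : measurable_fun (`[a, b]%classic : set (lebesgue_line R))
    (fun t : lebesgue_line R => (g t * plateau a b n.+1%:R t)%:E).
  by apply/measurable_EFinP; exact: measurable_funM.
have mf' : measurable_fun (`[a, b]%classic : set (lebesgue_line R))
    (fun t : lebesgue_line R => (g t * cutoff 1)%:E).
  by apply/measurable_EFinP; apply: measurable_funM => //; exact: measurable_cst.
have cvx : {ae leb, forall t, `[a, b]%classic t ->
    (g t * plateau a b n.+1%:R t)%:E @[n --> \oo] --> (g t * cutoff 1)%:E}.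
  exists ([set a] `|` [set b]); split.
  - exact: measurableU.
  - by apply: null_set_setU => //; exact: lebesgue_line_set1.
  - move=> t /=; apply: contra_notP => /not_orP[ta tb].
    rewrite in_itv/= => /andP[at_ tb'].
    apply: cvg_EFin; first exact: nearW.
    apply: cvgMr; apply: (@cvg_trans _ (cst (cutoff 1) @ \oo)); last exact: cvg_cst.
    apply: near_eq_cvg; near=> n; apply/esym.
    near: n; apply: near_plateau.
    by rewrite !lt_neqAle at_ tb' !andbT; apply/andP; split; apply/eqP => // /esym.
have ig2 : leb.-integrable `[a, b] (fun t => (2 * `|g t|)%:E).
  exact: (integrableZl mab 2 (integrable_abse ig)).
have dom : {ae leb, forall t, forall n, `[a, b]%classic t ->
    (`|(g t * plateau a b n.+1%:R t)%:E| <= (2 * `|g t|)%:E)%E}.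
  apply/aeW => t n _; rewrite abse_EFin lee_fin normrM mulrC.
  by rewrite ler_wpM2r// plateau_bounded.
have [_ _ cv] := dominated_convergence mab mf mf' cvx ig2 dom.
rewrite mulrC -RintegralZr//; apply: fine_cvg.
rewrite fineK; first exact: cv.
apply: integrable_fin_num => //.
rewrite (_ : (fun t => _) = fun t => ((cutoff 1)%:E * (g t)%:E)%E).
  exact: integrableZl.
by apply/funext => t; rewrite -EFinM mulrC.
Unshelve. all: by end_near. Qed.

Lemma Rintegral_plateau_out (I : set R) (a b : R) (f k : R -> R) :
  `[a, b] `<=` I -> (forall t, ~~ (a <= t <= b) -> k t = 0) ->
  \int[leb]_(t in I) (f t * k t) = \int[leb]_(t in `[a, b]) (f t * k t).
Proof.
move=> abI k0; rewrite Rintegral_mkcond [RHS]Rintegral_mkcond.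
congr (Rintegral _ _ _); apply/funext => t; rewrite /patch.
have [tab|tab] := boolP (t \in `[a, b]%classic).
  by rewrite mem_set//; apply: abI; exact: set_mem.
case: ifPn => // _; rewrite k0 ?mulr0//; apply: contra tab => tab.
by apply/mem_set; rewrite /= in_itv.
Qed.

Lemma near_itv_continuous (a b x e : R) (f : R -> R) : 0 < e ->
  a <= x <= b -> {within `[a, b], continuous f} ->
  exists2 d : R, 0 < d & forall t, a <= t <= b -> `|t - x| < d -> `|f t - f x| <= e.
Proof.
move=> e0 xab cf.
have xab' : `[a, b]%classic x by rewrite /= in_itv.
have /cvgrPdist_le /(_ e e0) := (@subspace_continuousP _ _ _ _).1 cf x xab'.
rewrite near_withinE => /nbhs_ballP[d /= d0 h]; exists d => // t tab tx.
rewrite distrC; apply: h; last by rewrite /= in_itv.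
by rewrite /ball/= distrC.
Qed.

(** Here [m] stands for the step width 1/l. Both steps lie within 2m of the ends of [a, b], hence
    within the radii [d1] and [d2] on which [f] is close to its end values. *)
Let plateau_room (a b m d1 d2 : R) : 0 < m ->
  m * 4 < b - a -> m * 4 < d1 -> m * 4 < d2 ->
  [/\ [/\ a + 3 * m <= b, a <= a + m, a + m + m <= b, a <= b - 2 * m &
         b - 2 * m + m <= b],
     (forall t : R, a + m < t < a + m + m \/ b - 2 * m < t < b - 2 * m + m
         \/ a + m < t < b - m -> a <= t <= b),
     (forall t : R, a + m <= t -> t <= a + m + m -> `|t - a| < d1) &
     (forall t : R, b - 2 * m <= t -> t <= b - 2 * m + m -> `|t - b| < d2)].
Proof.
move=> m0 mab md1 md2; split.
- by split; lra.
- by move=> t; case=> [|[]] /andP[? ?]; apply/andP; split; lra.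
- by move=> t h1 h2; rewrite ger0_norm; lra.
- by move=> t h1 h2; rewrite ler0_norm; lra.
Qed.

Lemma distributional_ftc (I : set R) (a b : R) (f g : R -> R) : a <= b ->
  `[a, b] `<=` I -> {within `[a, b], continuous f} ->
  leb.-integrable `[a, b] (EFin \o g) ->
  (forall psi, test_function I psi ->
    \int[leb]_(t in I) (f t * derive1 psi t) = - \int[leb]_(t in I) (g t * psi t)) ->
  f b - f a = \int[leb]_(t in `[a, b]) g t.
Proof.
rewrite le_eqVlt => /predU1P[->|ab] abI cf ig H.
  rewrite subrr set_itv1 /Rintegral null_set_integral; first by [].
  - by apply: measurable_lebesgue_line; exact: measurable_set1.
  - by rewrite -(set_itv1 b); exact: measurable_int ig.
  - exact: lebesgue_line_set1.
have c0 := @cutoff1_gt0 R.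
(* The step is not normalized, so its positive height [cutoff 1] is carried on both sides and
   cancelled. *)
suff E : cutoff 1 * (f b - f a) = cutoff 1 * \int[leb]_(t in `[a, b]) g t.
  by apply: (mulfI (lt0r_neq0 c0)).
apply/eqP; rewrite -subr_eq0 -normr_le0.
suff h (e : R) : 0 < e ->
    `|cutoff 1 * (f b - f a) - cutoff 1 * \int[leb]_(t in `[a, b]) g t| <= e.
  by apply/ler_addgt0Pl => e e0; rewrite addr0; exact: h.
move=> e0.
have M0 : 0 < M by rewrite mulr_gt0// ltr0n.
(* The error is at most [e' * M] at each of the two edges plus [e'] for the integral of [g]. *)
pose e' : R := e / (2 * M + 1).
have e'0 : 0 < e' by rewrite divr_gt0// addr_gt0// mulr_gt0.
have aab : a <= a <= b by rewrite lexx ltW.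
have bab : a <= b <= b by rewrite lexx ltW.
have [d1 d10 h1] := near_itv_continuous e'0 aab cf.
have [d2 d20 h2] := near_itv_continuous e'0 bab cf.
(* The divisor 4 provides the four step widths of room that [plateau_room] requires. *)
pose d : R := Order.min (Order.min d1 d2) (b - a) / 4.
have d0 : 0 < d by rewrite divr_gt0// !lt_min d10 d20 subr_gt0.
have near1 : \forall n \near \oo, (n.+1%:R^-1 : R) < d.
  exact: near_infty_natSinv_lt (PosNum d0).
have near2 : \forall n \near \oo,
    `|\int[leb]_(t in `[a, b]) (g t * plateau a b n.+1%:R t)
      - cutoff 1 * \int[leb]_(t in `[a, b]) g t| <= e'.
  have /cvgrPdist_le /(_ e' e'0) := integral_plateau_cvg ab ig.
  by apply: filterS => n; rewrite distrC.
have [l [l0 nd gn]] : exists l : R, [/\ 0 < l, l^-1 < d &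
    `|\int[leb]_(t in `[a, b]) (g t * plateau a b l t)
      - cutoff 1 * \int[leb]_(t in `[a, b]) g t| <= e'].
  have [n _ /(_ n (leqnn n))[]] := filterI near1 near2.
  by exists n.+1%:R; split.
have li : 0 < l^-1 by rewrite invr_gt0.
have : l^-1 * 4 < Order.min (Order.min d1 d2) (b - a) by rewrite -ltr_pdivlMr.
rewrite !lt_min => /andP[/andP[ld1 ld2] lab].
have test := @test_function_plateau I a b l l0 (_ : _ <= _) abI.
have [[r1 r2 r3 r4 r5] rt rd1 rd2] := plateau_room li lab ld1 ld2.
have out t : ~~ (a <= t <= b) -> plateau a b l t = 0.
  move=> tab; rewrite plateau_out//; apply: contra tab => ?; apply: rt.
  by right; right.
have := H _ (test r1).
rewrite [X in _ = - X](Rintegral_plateau_out g abI out) => {}H.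
have dplateau t : (plateau a b l)^`()%classic t =
    scaled_cutoff' l (a + l^-1) t - scaled_cutoff' l (b - 2 * l^-1) t.
  by rewrite derive1E; have [_ ->] := is_derive_plateau a b l t.
have I1 : `|\int[leb]_(t in `[a, b]) (f t * scaled_cutoff' l (a + l^-1) t) -
    cutoff 1 * f a| <= e' * M.
  apply: approximate_identity => // t /andP[t1 t2]; apply: h1; last exact: rd1.
  by rewrite (le_trans r2)// (le_trans t2).
have I2 : `|\int[leb]_(t in `[a, b]) (f t * scaled_cutoff' l (b - 2 * l^-1) t) -
    cutoff 1 * f b| <= e' * M.
  apply: approximate_identity => // t /andP[t1 t2]; apply: h2; last exact: rd2.
  by rewrite (le_trans r4)// (le_trans t2).
have fk p : leb.-integrable `[a, b] (EFin \o (fun t => f t * scaled_cutoff' l p t)).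
  apply: integrable_lebesgue_line => //.
  apply: continuous_compact_integrable; first exact: segment_compact.
  move=> t; apply: cvgM; first exact: cf.
  by apply: continuous_subspaceT; exact: scaled_cutoff'_continuous.
move: H; rewrite (Rintegral_plateau_out _ abI); last first.
  move=> t tab; rewrite dplateau !scaled_cutoff'_eq0 ?subrr//.
    by apply: contra tab => ?; apply: rt; right; left.
  by apply: contra tab => ?; apply: rt; left.
under eq_Rintegral do rewrite dplateau mulrBr.
rewrite RintegralB//; last exact: segment_lebesgue_line.
move: gn I1 I2; set G := Rintegral _ _ _; set G' := Rintegral _ _ _.
set A := Rintegral _ _ _; set B := Rintegral _ _ _; set c := cutoff 1.
move=> gn I1 I2 AB.
have -> : c * (f b - f a) - c * G' = (A - c * f a) - (B - c * f b) + (G - c * G').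
  have -> : G = B - A by rewrite -[LHS]opprK -AB opprB.
  rewrite !mulrBr; clear; lra.
have -> : e = e' * M + e' * M + e'.
  rewrite -mulrDr -[X in _ + X]mulr1 -mulrDr /e' [RHS]mulrC.
  have -> : M + M + 1 = 2 * M + 1 by rewrite mulr_natl.
  by rewrite mulrC divfK// gt_eqF// addr_gt0// mulr_gt0.
rewrite (le_trans (ler_normD _ _))// lerD// (le_trans (ler_normB _ _))//.
exact: lerD.
Qed.

End distribution.

(** * Chain rule along absolutely continuous curves *)

Section chain_rule.
Context {R : realType}.
Notation leb := (@completed_lebesgue_measure R).

Lemma derive_affine k (phi : 'rV[R]_k -> R) (x v : 'rV[R]_k) (s : R) :
  derivable phi (s *: v + x) v ->
  is_derive s (1 : R) (fun t : R => phi (t *: v + x)) ('D_v phi (s *: v + x)).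
Proof.
move=> dphi.
have E : (fun h : R => h^-1 *: (((fun t : R => phi (t *: v + x)) \o shift s) (h *: 1)
      - phi (s *: v + x))) =
    (fun h : R => h^-1 *: ((phi \o shift (s *: v + x)) (h *: v) - phi (s *: v + x))).
  by apply/funext => h /=; rewrite [h *: 1]mulr1 scalerDl addrA.
by apply: DeriveDef; rewrite /derivable /derive E.
Qed.

Lemma derive_partial k (phi : 'rV[R]_k -> R) (x v : 'rV[R]_k) :
  differentiable phi x ->
  'D_v phi x = \sum_(j < k) v 0 j * partial_derivative phi j x.
Proof.
move=> dphi; rewrite deriveE// [X in 'd phi x X]row_sum_delta.
rewrite linear_sum; apply: eq_bigr => j _.
by rewrite linearZ /partial_derivative deriveE.
Qed.

(** The one-variable mean value theorem along the segment from x to y; the intermediate point is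
    therefore the same for all coordinates. *)
Lemma mean_value_partial k (phi : 'rV[R]_k -> R) (x y : 'rV[R]_k) :
  (forall z, differentiable phi z) ->
  exists2 s : R, 0 <= s <= 1 &
    phi y - phi x = \sum_(j < k) (y - x) 0 j *
      partial_derivative phi j (s *: (y - x) + x).
Proof.
move=> dphi; pose h (t : R) := phi (t *: (y - x) + x).
have dh t : is_derive t (1 : R) h ('D_(y - x) phi (t *: (y - x) + x)).
  by apply: derive_affine; exact: diff_derivable.
have ch : {within `[0, 1], continuous h}.
  by apply: derivable_within_continuous => t _; have [] := dh t.
have [s s01] := @MVT R h _ 0 1 ltr01 (fun t _ => dh t) ch.
rewrite /h scale1r subrK scale0r add0r subr0 mulr1 derive_partial// => ->.
by exists s => //; move: s01; rewrite in_itv/= => /andP[s0 s1]; rewrite !ltW.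
Qed.

(** On the compact support each partial derivative is continuous, hence bounded; off it [phi]
    vanishes in a neighbourhood, so the partial derivatives are 0. Summing the bounds over [j] gives
    a common one. *)
Lemma partial_derivative_bounded k (phi : 'rV[R]_k -> R) :
  continuously_differentiable phi -> compactly_supported phi ->
  exists M : R, forall j x, `|partial_derivative phi j x| <= M.
Proof.
move=> [dphi cphi]; rewrite /compactly_supported; set S := closure _ => sphi.
have out j x : ~ S x -> partial_derivative phi j x = 0.
  move=> Sx; rewrite /partial_derivative.
  rewrite (_ : 'D_(delta_mx 0 j) phi x = 'D_(delta_mx 0 j) (cst 0 : 'rV[R]_k -> R) x).
    by rewrite derive_cst.
  apply: near_eq_derive.
  have : nbhs x (~` S) by apply: open_nbhs_nbhs; split => //; apply: closed_openC; exact: closed_closure.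
  apply: filterS => y Sy; apply/eqP/negPn/negP => y0; apply: Sy.
  exact: subset_closure.
have bd j : exists M : R, forall x, `|partial_derivative phi j x| <= M.
  have cimg : compact (partial_derivative phi j @` S).
    by apply: continuous_compact => //; apply: continuous_subspaceT; exact: cphi.
  have [M [_ /(_ (M + 1)) h]] := compact_bounded cimg.
  exists `|M + 1| => x; have [Sx|/out ->] := pselect (S x); last by rewrite normr0.
  by apply: le_trans (ler_norm _); apply: h; [rewrite ltrDl|exists x].
have [M h] := choice bd.
exists (\sum_j `|M j|) => j x; apply: (le_trans (h j x)).
by apply: (le_trans (ler_norm _)); rewrite (bigD1 j)//= lerDl sumr_ge0.
Qed.

(* Applied to an error estimate that is additive over adjacent intervals and
   holds near every point: compactness of [a, b] replaces differentiation almost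
   everywhere. *)
Lemma cousin (a b : R) (P : R -> R -> Prop) : a <= b ->
  (forall r s t, a <= r -> r <= s -> s <= t -> t <= b -> P r s -> P s t -> P r t) ->
  (forall s, a <= s <= b -> exists2 d : R, 0 < d & forall r t, a <= r -> r <= t ->
    t <= b -> `|r - s| < d -> `|t - s| < d -> P r t) ->
  P a b.
Proof.
move=> ab trans loc.
pose A := [set t | a <= t <= b /\ P a t].
have Aa : A a.
  have [|d d0 h] := loc a; first by rewrite lexx.
  by split; [rewrite lexx|apply: h => //; rewrite subrr normr0].
have supA : has_sup A.
  by split; [exists a|exists b => t [/andP[]]].
have as_ : a <= sup A by apply: sup_upper_bound.
have sb : sup A <= b by apply: ge_sup => [|t [/andP[]]//]; exists a.
have [|d d0 h] := loc (sup A); first by rewrite as_.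
have [t [/andP[at_ tb] Pt] st] : exists2 t, A t & sup A - d < t.
  by apply: sup_adherent.
have ts : t <= sup A by apply: sup_upper_bound => //; split => //; rewrite at_.
pose r := Order.min b (sup A + d / 2).
have sr : sup A <= r by rewrite le_min sb lerDl divr_ge0// ltW.
have rb : r <= b by rewrite ge_min lexx.
have Pr : P a r.
  apply: (trans a t r) => //; first exact: le_trans sr.
  apply: h => //; first exact: le_trans sr.
    by rewrite ler0_norm ?subr_le0// opprB ltrBlDl -ltrBlDr.
  rewrite ger0_norm ?subr_ge0// ltrBlDl.
  by rewrite (@le_lt_trans _ _ (sup A + d / 2))// ?ge_min ?lexx ?orbT// ltrD2l ltr_pdivrMr// ltr_pMr// ltr1n.
have rs : r <= sup A by apply: sup_upper_bound => //; split => //; rewrite (le_trans as_).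
move: rs; rewrite /r ge_min => /orP[bs|]; last first.
  by rewrite gerDl leNgt divr_gt0.
have -> : b = r; last exact: Pr.
by apply/eqP; rewrite eq_le rb andbT (le_trans bs).
Qed.

Lemma integrable_bounded_mul d (T : measurableType d)
    (mu : {measure set T -> \bar R}) (D : set T) (h g : T -> R) (M : R) :
  measurable D -> measurable_fun D h -> (forall x, D x -> `|h x| <= M) ->
  mu.-integrable D (EFin \o g) -> mu.-integrable D (EFin \o (fun x => h x * g x)).
Proof.
move=> mD mh hM ig.
have mg : measurable_fun D g by apply/measurable_EFinP; exact: measurable_int ig.
apply: (le_integrable mD _ _ (integrableZl mD M (integrable_abse ig))).
  by apply/measurable_EFinP; exact: measurable_funM.
move=> x Dx /=; have M0 : 0 <= M by apply: le_trans (hM x Dx).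
by rewrite lee_fin normrM normrM normr_id (ger0_norm M0) ler_wpM2r// hM.
Qed.

Lemma integrable_sum_ord d (T : measurableType d)
    (mu : {measure set T -> \bar R}) (D : set T) k (g : 'I_k -> T -> R) :
  measurable D -> (forall j, mu.-integrable D (EFin \o g j)) ->
  mu.-integrable D (EFin \o (fun x => \sum_j g j x)).
Proof.
move=> mD ig; rewrite (_ : _ \o _ = fun x => (\sum_(j <- enum 'I_k) (EFin \o g j) x)%E).
  exact: integrable_sum.
by apply/funext => x /=; rewrite -sumEFin big_enum.
Qed.

Lemma Rintegral_sum_ord d (T : measurableType d)
    (mu : {measure set T -> \bar R}) (D : set T) k (g : 'I_k -> T -> R) :
  measurable D -> (forall j, mu.-integrable D (EFin \o g j)) ->
  \int[mu]_(x in D) (\sum_j g j x) = \sum_j \int[mu]_(x in D) g j x.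
Proof.
move=> mD; elim: k g => [|k IH] g ig.
  rewrite big_ord0; under eq_Rintegral do rewrite big_ord0.
  by rewrite /Rintegral integral0.
under eq_Rintegral do rewrite big_ord_recr/=.
rewrite RintegralD; [|exact: mD|exact: integrable_sum_ord|exact: ig].
by rewrite big_ord_recr/= IH.
Qed.

Lemma row_continuous (A : set R) k (f : R -> 'rV[R]_k) :
  (forall j, {within A, continuous (fun t => f t 0 j)}) ->
  {within A, continuous f}.
Proof.
move=> cf; apply/subspace_continuousP => x Ax; apply/cvg_ballP => e e0.
have : \forall y \near within A (nbhs x), forall j, ball (f x 0 j) e (f y 0 j).
  apply: filter_forall => j.
  by have /cvg_ballP /(_ _ e0) := (@subspace_continuousP _ _ _ _).1 (cf j) x Ax.
by apply: filterS => y h; split => // i j; rewrite (ord1 i).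
Qed.

Lemma integral_segment_split (a s b : R) (g : R -> R) : a <= s -> s <= b ->
  leb.-integrable `[a, b] (EFin \o g) ->
  \int[leb]_(t in `[a, b]) g t =
  \int[leb]_(t in `[a, s]) g t + \int[leb]_(t in `[s, b]) g t.
Proof.
move=> as_ sb ig; have m := @segment_lebesgue_line R.
have m1 : measurable ([set s] : set (lebesgue_line R)).
  by apply: measurable_lebesgue_line; exact: measurable_set1.
(* The shared point [s] is removed to make the union disjoint, and put back below as a null set. *)
have E : `[a, b]%classic = `[a, s] `|` (`[s, b] `\ s).
  apply/seteqP; split => t /=; rewrite !in_itv/=.
    move=> /andP[at_ tb]; have [ts|st] := leP t s; [left|right].
      by rewrite at_.
    by split; [rewrite (ltW st)|apply/eqP; rewrite gt_eqF].
  by case=> [/andP[-> ts]|[/andP[st ->] _]]; rewrite ?(le_trans ts)// (le_trans as_).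
have mD : measurable (`[s, b] `\ s : set (lebesgue_line R)) by exact: measurableD.
rewrite [in LHS]E Rintegral_setU//; last 2 first.
- by rewrite -E.
- apply/disj_setPS => t [/=]; rewrite !in_itv/= => /andP[_ ts] [/andP[st _]].
  by apply; apply/eqP; rewrite eq_le ts.
congr (_ + _); apply/esym; rewrite /Rintegral; congr fine.
apply: negligible_integral => //; last exact: lebesgue_line_set1.
apply: integrableS ig => // t /=; rewrite !in_itv/= => /andP[st ->].
by rewrite (le_trans as_).
Qed.

Let addition_rearrange (A B x y z : R) :
  z - x - (A + B) = y - x - A + (z - y - B).
Proof. lra. Qed.

Let convex_rearrange (c x y z : R) :
  x - (c * (y - z) + z) = c * (x - y) + (1 - c) * (x - z).
Proof. lra. Qed.

Let convex_lt (c u v n : R) : 0 <= c -> c <= 1 -> u < n -> v < n ->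
  c * v + (1 - c) * u < n.
Proof.
move=> c0 c1 un vn; pose w := Order.max u v.
have cv : c * v <= c * w by rewrite ler_wpM2l// le_max lexx orbT.
have cu : (1 - c) * u <= (1 - c) * w by rewrite ler_wpM2l ?subr_ge0// le_max lexx.
rewrite (le_lt_trans (lerD cv cu))// -mulrDl addrC subrK mul1r.
by rewrite gt_max un vn.
Qed.

Let distance_between (r x t s d : R) : r <= x -> x <= t ->
  `|r - s| < d -> `|t - s| < d -> `|x - s| < d.
Proof.
rewrite !ltr_norml => rx xt /andP[? ?] /andP[? ?].
by apply/andP; split; lra.
Qed.

Let distance_halves (e u v w : R) : `|v - w| <= e / 2 -> `|u - w| <= e / 2 ->
  `|u - v| <= e.
Proof.
by rewrite !ler_norml => /andP[? ?] /andP[? ?]; apply/andP; split; lra.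
Qed.

Section c1_composition.
Variables (k : nat) (phi : 'rV[R]_k -> R) (a b : R).
Variables (f : R -> 'rV[R]_k) (g : 'I_k -> R -> R).
Hypotheses (C1phi : continuously_differentiable phi)
  (sphi : compactly_supported phi) (ab : a <= b)
  (cf : forall j, {within `[a, b], continuous (fun t => f t 0 j)})
  (ig : forall j, leb.-integrable `[a, b] (EFin \o g j))
  (fg : forall j r t, a <= r -> r <= t -> t <= b ->
    f t 0 j - f r 0 j = \int[leb]_(s in `[r, t]) g j s).

Let dphi (t : R) : R := \sum_j partial_derivative phi j (f t) * g j t.

Let integrable_term j :
  leb.-integrable `[a, b] (EFin \o (fun t => partial_derivative phi j (f t) * g j t)).
Proof.
have [M hM] := partial_derivative_bounded C1phi sphi.
have mab := segment_lebesgue_line a b.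
apply: (integrable_bounded_mul mab _ (fun x _ => hM j (f x)) (ig j)).
apply: measurable_fun_lebesgue_line; first exact: measurable_itv.
apply: subspace_continuous_measurable_fun; first exact: measurable_itv.
move=> t; apply: (@continuous_comp (subspace `[a, b]) _ _ f (partial_derivative phi j)).
  exact: row_continuous.
by case: C1phi => _; apply.
Qed.

Lemma integrable_chain_rule : leb.-integrable `[a, b] (EFin \o dphi).
Proof. exact: (integrable_sum_ord (segment_lebesgue_line a b) integrable_term). Qed.

(** Measuring the error on [r, t] against the integral of [G], the sum of the |g j|, rather than
    against the length t - r, makes the estimate additive and valid near every point, even where [g]
    is unbounded. *)
Lemma chain_rule : phi (f b) - phi (f a) = \int[leb]_(t in `[a, b]) dphi t.
Proof.
have m := @segment_lebesgue_line R.
pose G (t : R) : R := \sum_j `|g j t|.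
have iG : leb.-integrable `[a, b] (EFin \o G).
  apply: integrable_sum_ord; first exact: m.
  by move=> j; exact: (integrable_abse (ig j)).
have sub r t : a <= r -> t <= b -> (`[r, t] `<=` `[a, b])%classic.
  move=> ar tb s /=; rewrite !in_itv/= => /andP[rs st].
  by rewrite (le_trans ar)// (le_trans st).
have iS (h : R -> R) r t : a <= r -> t <= b -> leb.-integrable `[a, b] (EFin \o h) ->
    leb.-integrable `[r, t] (EFin \o h).
  by move=> ar tb; apply: integrableS; [exact: m|exact: m|exact: sub].
suff main (e : R) : 0 < e ->
    `|phi (f b) - phi (f a) - \int[leb]_(t in `[a, b]) dphi t|
      <= e * \int[leb]_(t in `[a, b]) G t.
  have G0 : 0 <= \int[leb]_(t in `[a, b]) G t.
    by apply: Rintegral_ge0 => t _; exact: sumr_ge0.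
  apply/eqP; rewrite -subr_eq0 -normr_le0; apply/ler_addgt0Pl => e e0.
  rewrite addr0; pose J : R := \int[leb]_(t in `[a, b]) G t.
  have J1 : 0 < J + 1 by apply: ltr_wpDl.
  (* The added 1 keeps the denominator positive when the integral [J] of [G] is 0. *)
  apply: (le_trans (main (e / (J + 1)) _)); first by rewrite divr_gt0.
  by rewrite -/J mulrAC ler_pdivrMr// ler_pM2l// lerDl.
move=> e0; apply: (@cousin a b (fun r t =>
  `|phi (f t) - phi (f r) - \int[leb]_(t in `[r, t]) dphi t|
      <= e * \int[leb]_(t in `[r, t]) G t)) => //.
  move=> r s t ar rs st tb H1 H2.
  rewrite (integral_segment_split rs st); last first.
    by apply: iS => //; exact: integrable_chain_rule.
  rewrite (integral_segment_split (g := G) rs st); last exact: iS.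
  rewrite mulrDr; apply: le_trans (lerD H1 H2); apply: le_trans (ler_normD _ _).
  rewrite le_eqVlt; apply/orP; left; apply/eqP; congr `|_|.
  exact: addition_rearrange.
move=> s sab.
have cphi : \forall y \near f s, forall j,
    `|partial_derivative phi j y - partial_derivative phi j (f s)| <= e / 2.
  apply: (@filter_forall _ _ (fun j => [set y | `|partial_derivative phi j y -
    partial_derivative phi j (f s)| <= e / 2]) (nbhs (f s)) _) => j.
  case: C1phi => _ /(_ j (f s)) /cvgrPdist_le.
  have e20 : 0 < e / 2 by rewrite divr_gt0.
  by move=> /(_ _ e20); apply: filterS => y; rewrite distrC.
move/nbhs_ballP : cphi => [n /= n0 hn].
have /cvg_ballP /(_ _ n0) := (@subspace_continuousP _ _ _ _).1 (row_continuous cf) s sab.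
rewrite near_withinE => /nbhs_ballP[d /= d0 hd].
have {}hd t : a <= t -> t <= b -> `|t - s| < d -> forall j, `|f s 0 j - f t 0 j| < n.
  move=> at_ tb ts j; have ts' : ball s d t by rewrite /ball/= distrC.
  have tab : t \in `[a, b] by rewrite in_itv/= at_.
  by have [_ /(_ 0 j)] := hd t ts' tab.
exists d => // r t ar rt tb rd td.
have at_ : a <= t by exact: le_trans rt.
have rb : r <= b by exact: le_trans tb.
have [c /andP[c0 c1] ->] := mean_value_partial (f r) (f t) C1phi.1.
set xi := c *: _ + _.
(* [xi] is a convex combination of [f t] and [f r], so each of its coordinates stays within [n] of
   that of [f s]. *)
have hxi j : `|partial_derivative phi j xi - partial_derivative phi j (f s)| <= e / 2.
  apply: hn; split => // i l; rewrite (ord1 i) /ball/= !mxE.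
  rewrite convex_rearrange (le_lt_trans (ler_normD _ _))// !normrM (ger0_norm c0)
    (@ger0_norm _ (1 - c)) ?subr_ge0//.
  by apply: convex_lt => //; apply: hd.
have hft x : r <= x -> x <= t -> forall j,
    `|partial_derivative phi j (f x) - partial_derivative phi j (f s)| <= e / 2.
  move=> rx xt j; apply: hn; split => // i l; rewrite (ord1 i) /ball/=.
  by apply: hd; [exact: le_trans rx|exact: le_trans tb|exact: distance_between rd td].
(* The coefficients at [xi] are constants and the increments of [f] are integrals of the [g j]: the
   increment of [phi] becomes a single integral, comparable with that of [dphi] under the integral
   sign. *)
have -> : \sum_j (f t - f r) 0 j * partial_derivative phi j xi =
    \int[leb]_(x in `[r, t]) (\sum_j partial_derivative phi j xi * g j x).
  rewrite Rintegral_sum_ord; last 2 first.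
  - exact: m.
  - move=> j; apply: (iS (fun x => partial_derivative phi j xi * g j x)) => //.
    exact: (integrableZl (m a b) (partial_derivative phi j xi) (ig j)).
  apply: eq_bigr => j _; rewrite !mxE (fg j ar rt tb) mulrC RintegralZl//.
  exact: iS.
have ixi : leb.-integrable `[r, t]
    (EFin \o (fun x => \sum_j partial_derivative phi j xi * g j x)).
  apply: integrable_sum_ord; first exact: m.
  move=> j; apply: (iS (fun x => partial_derivative phi j xi * g j x)) => //.
  exact: (integrableZl (m a b) (partial_derivative phi j xi) (ig j)).
have idphi : leb.-integrable `[r, t] (EFin \o dphi).
  by apply: iS => //; exact: integrable_chain_rule.
rewrite -RintegralB; [|exact: m|exact: ixi|exact: idphi].
have iB : leb.-integrable `[r, t]
    (EFin \o (fun x => \sum_j partial_derivative phi j xi * g j x - dphi x)).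
  exact: (integrableB (m r t) ixi idphi).
apply: (le_trans (le_normr_Rintegral (m r t) iB)).
rewrite -RintegralZl; [|exact: m|exact: iS].
apply: le_Rintegral; first exact: m.
- exact: (integrable_abse iB).
- exact: (integrableZl (m r t) e (iS _ _ _ ar tb iG)).
move=> x /=; rewrite in_itv/= => /andP[rx xt].
rewrite /dphi -sumrB mulr_sumr (le_trans (ler_norm_sum _ _ _))//.
apply: ler_sum => j _; rewrite -mulrBl normrM ler_wpM2r//.
exact: distance_halves (hft x rx xt j) (hxi j).
Qed.

End c1_composition.

End chain_rule.

(** * Measurability of evaluation and of the field along trajectories *)

Section extension_by_default.
Context {U : Type} {T : Type} (I : set U).

Lemma valL_val (y : T) (f : I -> T) (t : I) : 'valL_ y f (val t) = f t.
Proof. by rewrite /valL_ /= oinv_set_val valK. Qed.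

Lemma valL_out (y : T) (f : I -> T) (t : U) : ~ I t -> 'valL_ y f t = y.
Proof.
by move=> It; rewrite /valL_ /= oinv_set_val insubF//; apply/negP => /set_mem.
Qed.

End extension_by_default.

Lemma valL_comp {U T T' : Type} (I : set U) (h : T -> T') (y : T) (f : I -> T) :
  'valL_ (h y) (fun t => h (f t)) = h \o 'valL_ y f.
Proof.
apply/funext => t; have [It|It] := pselect (I t); last first.
  by rewrite /comp !valL_out.
pose t' : I := exist (fun x => x \in I) t (mem_set It).
by rewrite /comp (_ : t = val t')// !valL_val.
Qed.

Section borel_measurability.
Context {R : realType}.

Lemma continuous_borel_measurable (T : ptopologicalType) (h : T -> R) :
  continuous h -> measurable_fun setT (h : borel T -> R).
Proof.
move=> /continuousP ch; apply: (measurability _ (RGenOpens.measurableE R)) => //.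
move=> _ [_ [x [y ->] <-]]; rewrite setTI; apply: sub_sigma_algebra.
by apply: ch; exact: interval_open.
Qed.

Context {Y : topologicalLmodType R}.

(** Scalar multiplication is continuous at (0, v), so x v lies in [U] for |x| < d; then v = s (s^-1
    v) belongs to s U as soon as s > 1/d. *)
Lemma tvs_bounded_set1 (v : Y) : tvs_bounded [set v].
Proof.
move=> U U0.
have c : (fun z : R^o * Y => z.1 *: z.2) @ ((0 : R^o), v) --> (0 : Y).
  by have := @scale_continuous R Y ((0 : R^o), v); rewrite /continuous_at /= scale0r.
have [[A B] /= [/nbhs_ballP[d /= d0 dA] Bv] AB] := c U U0.
have h x : ball (0 : R) d x -> U (x *: v).
  by move=> dx; apply: (AB (x, v)); split; [exact: dA|exact: nbhs_singleton].
exists d^-1; first by rewrite invr_gt0.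
move=> s ds _ ->; have s0 : 0 < s by apply: lt_trans ds; rewrite invr_gt0.
exists (s^-1 *: v); last by rewrite scalerA divff ?scale1r// gt_eqF.
apply: h; rewrite /ball/= sub0r normrN gtr0_norm ?invr_gt0//.
by rewrite invf_plt ?posrE.
Qed.

(** Uniform convergence on the bounded set {v} is convergence at v. This is how strong Borel
    measurability of [F] passes to its pairings. *)
Lemma strong_dual_eval_continuous (v : Y) :
  continuous ((fun w => w v) : strong_dual Y -> R).
Proof.
move=> w; have h := @initial_continuous (dual Y) _
  (fun w : dual Y => (w : {family @tvs_bounded R Y, Y -> R})) w.
have FF := fmap_filter (fun x : strong_dual Y => x : Y -> R)
  (@nbhs_filter (strong_dual Y) w).
have := (fam_cvgP _ _ FF).1 h [set v] (tvs_bounded_set1 v).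
by rewrite (uniform_set1 _ _ FF).
Qed.

Lemma measurable_strong_dual_eval (v : Y) :
  measurable_fun setT ((fun w => w v) : borel (strong_dual Y) -> R).
Proof. by apply: continuous_borel_measurable; exact: strong_dual_eval_continuous. Qed.

Lemma weakstar_dual_eval_continuous (v : Y) :
  continuous ((fun w => w v) : weakstar_dual Y -> R).
Proof.
move=> w; have h := @initial_continuous (dual Y) _
  (fun w : dual Y => (w : {ptws Y -> R})) w.
have FF := fmap_filter (fun x : weakstar_dual Y => x : Y -> R)
  (@nbhs_filter (weakstar_dual Y) w).
exact: ((pointwise_cvgP _ FF).1 h v).
Qed.

End borel_measurability.

Section joint_evaluation.
Context {R : realType} (I : set R) (hI : is_interval I) (X : ptopologicalType).

(** The set is the image of the real segment under clamping to [c, d], a continuous map from the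
    line whose values lie in [I] because [I] is an interval. *)
Lemma set_type_segment_compact (c d : I) : val c <= val d ->
  compact [set s : I | val c <= val s <= val d].
Proof.
move=> cd.
have Iclamp (t : R) : I (Order.max (val c) (Order.min (val d) t)).
  apply: (hI (set_mem (valP c)) (set_mem (valP d))).
  by rewrite le_max lexx ge_max cd ge_min lexx.
pose r (t : R) : I := exist (fun x => x \in I) _ (mem_set (Iclamp t)).
have cr : continuous r.
  apply/continuousP => _ [B oB <-]; apply: (open_comp _ oB) => t _.
  apply: (@continuous_max _ _ (cst (val c)) (cst (val d) \min (id : R -> R)) t).
    exact: cvg_cst.
  by apply: continuous_min => //; exact: cvg_cst.
have -> : [set s : I | val c <= val s <= val d] = r @` `[val c, val d].
  apply/seteqP; split => [s /= /andP[cs sd]|_ [t /= tcd <-]].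
    exists (val s); first by rewrite in_itv/= cs sd.
    by apply: val_inj => /=; rewrite (min_r sd) (max_r cs).
  by rewrite le_max lexx ge_max cd ge_min lexx.
apply: continuous_compact; last exact: segment_compact.
exact: continuous_subspaceT.
Qed.

(** By continuity [u] maps some segment [K] of [I] around t into [O], and [K], being compact,
    defines an open set of trajectories. The rationals [p] and [q] may lie outside [I]: only the
    points of [I] between them have to belong to [K]. *)
Lemma traj_open_nbhs (t : I) (u : traj I X) (O : set X) : open O -> O (u t) ->
  exists p q : rat, [/\ ratr p <= val t <= ratr q &
    exists2 W : set (traj I X), open W & W u /\
      forall (w : traj I X) (s : I), W w -> ratr p <= val s <= ratr q -> O (w s)].
Proof.
move=> oO Out.
have : nbhs t (u @^-1` O).
  have cu : continuous (u : I -> X) by exact: cts_fun.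
  by apply: cu; exact: open_nbhs_nbhs.
case=> _ [[B oB <-] Bt BO].
have /nbhs_ballP[e /= e0 be] : nbhs (val t) B by exact: open_nbhs_nbhs.
have {BO be}near_t (s : I) : `|val t - val s| < e -> O (u s).
  by move=> ts; apply: BO; apply: be.
(* If no point of I precedes t within distance e, then c = t works, with a
   lower barrier c0 outside I; likewise on the right. *)
have [c [c0 [ct c0t c0t' uc]]] : exists c : I, exists c0 : R, [/\ val c <= val t, c0 < val t,
    forall s : I, c0 < val s -> val c <= val s &
    (forall s : I, val c <= val s -> val t - e < val s)].
  have [[s [s1 s2]]|ns] := pselect (exists s : I, val t - e < val s /\ val s < val t).
    exists s, (val s); split => //; first exact: ltW.
      by move=> x /ltW.
    by move=> x; exact: lt_le_trans.
  exists t, (val t - e); split => //.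
  - by rewrite ltrBlDr ltrDl.
  - move=> s ts; rewrite leNgt; apply/negP => st; apply: ns; exists s; split => //.
  - by move=> x; apply: lt_le_trans; rewrite ltrBlDr ltrDl.
have [d [d0 [td d0t d0t' ud]]] : exists d : I, exists d0 : R, [/\ val t <= val d, val t < d0,
    forall s : I, val s < d0 -> val s <= val d &
    (forall s : I, val s <= val d -> val s < val t + e)].
  have [[s [s1 s2]]|ns] := pselect (exists s : I, val s < val t + e /\ val t < val s).
    exists s, (val s); split => //; first exact: ltW.
      by move=> x /ltW.
    by move=> x sx; exact: le_lt_trans s1.
  exists t, (val t + e); split => //.
  - by rewrite ltrDl.
  - move=> s ts; rewrite leNgt; apply/negP => st; apply: ns; exists s; split => //.
  - by move=> x sx; apply: le_lt_trans sx _; rewrite ltrDl.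
have [p] := rat_in_itvoo c0t; rewrite in_itv/= => /andP[cp pt].
have [q] := rat_in_itvoo d0t; rewrite in_itv/= => /andP[tq qd].
exists p, q; split; first by rewrite !ltW.
pose K := [set s : I | val c <= val s <= val d].
apply: (ex_intro2 _ _ [set w : traj I X | (traj_fun w) @` K `<=` O]); last split.
- exists [set g : I -> X | g @` K `<=` O] => //.
  by apply: compact_open_open => //; apply: set_type_segment_compact; exact: le_trans td.
- move=> _ [s /andP[cs sd] <-]; apply: near_t.
  by rewrite ltr_distlC uc// ud.
- move=> w s Ww /andP[ps sq]; apply: Ww; exists s => //=; apply/andP; split.
    by apply: c0t'; exact: lt_le_trans ps.
  by apply: d0t'; exact: le_lt_trans qd.
Qed.

(** Time ranges over the whole line, with a default value off [I], so that the map is total on the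
    product space on which the product measure lives. *)
Definition joint_eval (p : lebesgue_line R * borel (traj I X)) : X :=
  'valL_ point (traj_fun (p.2 : traj I X)) p.1.

Lemma joint_evalE (t : I) (u : traj I X) : joint_eval (val t, u) = u t.
Proof. exact: valL_val. Qed.

Lemma measurable_interval_lebesgue_line : measurable (I : set (lebesgue_line R)).
Proof. by apply: measurable_lebesgue_line; exact: is_interval_measurable. Qed.

(* The sets W below are arbitrary unions of open sets, hence no countability
   assumption on the topology of X is needed. *)
Lemma measurable_joint_eval :
  measurable_fun setT (joint_eval : _ -> borel X).
Proof.
have mI := measurable_interval_lebesgue_line.
have mIT : measurable (I `*` setT : set (lebesgue_line R * borel (traj I X))%type).
  exact: measurableX.
(* Restriction also uses [point] as its default, so the map equals its own restriction and only
   times in [I] need to be examined. *)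
have -> : joint_eval = (joint_eval : _ -> borel X) \_ (I `*` setT).
  apply/funext => -[t u]; rewrite patchE; case: ifPn => // /negP nI.
  by apply: valL_out => It; apply: nI; exact/mem_set.
apply/(measurable_restrictT _ mIT).
apply: (@measurability _ _ _ (borel X) _ _ (open : set (set X))) => //.
move=> _ [G oG <-].
pose W (p q : rat) : set (traj I X) := \bigcup_(W in [set W | open W /\
  forall (w : traj I X) (s : I), W w -> ratr p <= val s <= ratr q -> G (w s)]) W.
have -> : (I `*` setT) `&` joint_eval @^-1` G =
  \bigcup_p \bigcup_q ((I `&` `[ratr p, ratr q]) `*` W p q)
    :> set (lebesgue_line R * borel (traj I X)).
  apply/seteqP; split => [[t u] [[/= It _]]|[t u]].
    pose t' : I := exist (fun x => x \in I) t (mem_set It).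
    rewrite (_ : t = val t')// joint_evalE => Out.
    have [p [q [pq [A oA [Au AO]]]]] := traj_open_nbhs oG Out.
    exists p => //; exists q => //; split => /=; first by split => //; rewrite in_itv.
    by exists A.
  move=> [p _ [q _ [/= [It tpq] [A [oA AO] Au]]]]; split; first by [].
  pose t' : I := exist (fun x => x \in I) t (mem_set It).
  rewrite /= (_ : t = val t')// joint_evalE; apply: (AO u t' Au).
  by move: tpq; rewrite in_itv.
apply: bigcupT_measurable_rat => p; apply: bigcupT_measurable_rat => q.
apply: measurableX.
  by apply: measurableI => //; apply: measurable_lebesgue_line; exact: measurable_itv.
by apply: sub_sigma_algebra; apply: bigcup_open => A [].
Qed.

End joint_evaluation.

Section joint_vector_field.
Context {R : realType} {Y : topologicalLmodType R} {X Z : ptopologicalType}.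
Context (I : set R) (hI : is_interval I).
Context (iZX : Z -> X) (iZX_inj : injective iZX).
Context (hB : forall B : set (borel Z),
  measurable B -> measurable (iZX @` B : set (borel X))).
Context (F : R -> Z -> dual Y).
Context (mF : measurable_fun
  (I `*` setT : set (lebesgue_line R * borel Z)%type)
  (fun p => F p.1 p.2 : borel (strong_dual Y))).

Definition left_inverse (x : X) : Z :=
  if pselect (exists z, iZX z = x) is left h then sval (cid h) else point.

Lemma left_inverseK z : left_inverse (iZX z) = z.
Proof.
rewrite /left_inverse; case: pselect => [h|]; last by case; exists z.
by apply: iZX_inj; exact: (svalP (cid h)).
Qed.

Lemma measurable_range_inclusion : measurable (range iZX : set (borel X)).
Proof. exact: hB. Qed.

(** The preimage of [B] is its image in X, together with the complement of Z when the default
    [point] belongs to [B]; both are Borel by the hypothesis on images of Borel sets. *)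
Lemma measurable_left_inverse :
  measurable_fun setT (left_inverse : borel X -> borel Z).
Proof.
move=> _ B mB; rewrite setTI.
have -> : left_inverse @^-1` B =
    iZX @` B `|` (if `[< B point >] then ~` range iZX else set0) :> set (borel X).
  apply/seteqP; split => [x /= Bx|x [[z Bz <-]|]] /=.
  - have [[z _ zx]|nx] := pselect (range iZX x).
      by left; exists z => //; rewrite -zx left_inverseK in Bx.
    right; move: Bx; rewrite /left_inverse; case: pselect => [[z zx]|_ Bp].
      by exfalso; apply: nx; exists z.
    by rewrite asboolT.
  - by rewrite left_inverseK.
  - case: asboolP => // Bp nx; rewrite /left_inverse; case: pselect => // -[z zx].
    by exfalso; apply: nx; exists z.
apply: measurableU; first exact: hB.
by case: ifP => // _; apply: measurableC; exact: measurable_range_inclusion.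
Qed.

Lemma extZE (G : Z -> dual Y) (x : X) (v : Y) :
  extZ iZX G x v = ((fun x => G (left_inverse x) v) \_ (range iZX)) x.
Proof.
rewrite /extZ /left_inverse patchE; case: pselect => [h|h].
  by rewrite mem_set//; case: (h) => z zx; exists z.
by rewrite memNset// => -[z _ zx]; apply: h; exists z.
Qed.

Definition joint_field (v : Y) (p : lebesgue_line R * borel (traj I X)) : R :=
  'valL_ 0 (fun t : I => vfield iZX F t ((p.2 : traj I X) t) v) p.1.

Lemma joint_fieldE (v : Y) (t : I) (u : traj I X) :
  joint_field v (val t, u) = vfield iZX F t (u t) v.
Proof. exact: (valL_val 0 (fun t : I => vfield iZX F t (u t) v)). Qed.

Lemma joint_field_out (v : Y) (t : R) (u : traj I X) : ~ I t ->
  joint_field v (t, u) = 0.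
Proof. exact: (valL_out 0 (fun t : I => vfield iZX F t (u t) v)). Qed.

(** On the measurable set [D] of pairs with t in [I] and u(t) in Z, the field is [F] composed with
    (t, u) |-> (t, u(t)), the second component being read in Z by the left inverse; off [D] it is
    0. *)
Lemma measurable_joint_field (v : Y) : measurable_fun setT (joint_field v).
Proof.
pose D : set (lebesgue_line R * borel (traj I X)) :=
  (I `*` setT) `&` @joint_eval R I X @^-1` (range iZX).
have mI := measurable_interval_lebesgue_line hI.
have mIT : measurable (I `*` setT : set (lebesgue_line R * borel (traj I X))%type).
  exact: measurableX.
have mJ := @measurable_joint_eval R I hI X.
have mD : measurable D.
  apply: measurableI => //; rewrite -[X in measurable X]setTI.
  by apply: mJ => //; exact: measurable_range_inclusion.
have -> : joint_field v = (fun p => F p.1 (left_inverse (@joint_eval R I X p)) v) \_ D.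
  apply/funext => -[t u]; rewrite patchE.
  have [It|nIt] := pselect (I t); last first.
    by rewrite joint_field_out// memNset// => -[[]].
  pose t' : I := exist (fun x => x \in I) t (mem_set It).
  have Dt : D (val t', u) <-> range iZX ((u : traj I X) t').
    by rewrite -joint_evalE; split=> [[]|]; [|split].
  rewrite (_ : t = val t')// joint_fieldE joint_evalE /vfield extZE patchE.
  by case: ifPn => [/set_mem h|/negP h];
    [rewrite mem_set//; exact/Dt|rewrite memNset// => /Dt/mem_set].
apply/(measurable_restrictT _ mD).
pose e : lebesgue_line R * borel (traj I X) -> lebesgue_line R * borel Z :=
  fun p => (p.1, left_inverse (@joint_eval R I X p)).
have me : measurable_fun setT e.
  apply: measurable_fun_pair; first exact: measurable_fst.
  exact: measurableT_comp measurable_left_inverse mJ.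
apply: (measurableT_comp (measurable_strong_dual_eval v)).
apply: (measurable_comp _ _ mF (measurable_funS measurableT (@subsetT _ D) me)).
  exact: measurableX.
by move=> _ [p [[Ip _] _] <-].
Qed.

End joint_vector_field.

(** * Fubini on rectangles *)

Section product_rectangle.
Context d1 d2 (T1 : measurableType d1) (T2 : measurableType d2) {R : realType}.
Context (m1 : {sigma_finite_measure set T1 -> \bar R})
  (m2 : {sigma_finite_measure set T2 -> \bar R}).
Context (A : set T1) (B : set T2) (mA : measurable A) (mB : measurable B).
Implicit Type f : T1 * T2 -> R.

(** Product integrals are taken over the whole space with the integrand extended by 0 off A x B; the
    iterated integrals are brought back to A and B here. *)
Let integral_rect2 f x :
  (\int[m2]_y (EFin \o f \_ (A `*` B)) (x, y) =
   ((fun x => \int[m2]_(y in B) (f (x, y))%:E) \_ A) x)%E.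
Proof.
rewrite [RHS]patchE; case: ifPn => [/set_mem Ax|/negP Ax].
  rewrite [RHS]integral_mkcond; apply: eq_integral => y _.
  rewrite /= !patchE; case: ifPn => [/set_mem[_ By]|/negP nAB].
    by rewrite mem_set.
  by rewrite memNset// => By; apply: nAB; exact/mem_set.
rewrite integral0_eq// => y _; rewrite /= patchE memNset// => -[] /mem_set.
by move=> h _; exact: Ax.
Qed.

Let integral_rect1 f y :
  (\int[m1]_x (EFin \o f \_ (A `*` B)) (x, y) =
   ((fun y => \int[m1]_(x in A) (f (x, y))%:E) \_ B) y)%E.
Proof.
rewrite [RHS]patchE; case: ifPn => [/set_mem By|/negP By].
  rewrite [RHS]integral_mkcond; apply: eq_integral => x _.
  rewrite /= !patchE; case: ifPn => [/set_mem[Ax _]|/negP nAB].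
    by rewrite mem_set.
  by rewrite memNset// => Ax; apply: nAB; exact/mem_set.
rewrite integral0_eq// => x _; rewrite /= patchE memNset// => -[_] /mem_set.
exact: By.
Qed.

Lemma integrable_rectangle f : measurable_fun setT f ->
  m1.-integrable A (fun x => \int[m2]_(y in B) `|(f (x, y))%:E|)%E ->
  (m1 \x m2)%E.-integrable setT (EFin \o f \_ (A `*` B)).
Proof.
move=> mf /integrableP[_ ioo].
have mfr : measurable_fun setT (EFin \o f \_ (A `*` B)).
  apply/measurable_EFinP; apply/(measurable_restrictT _ (measurableX mA mB)).
  exact: measurable_funS mf.
apply/integrable12ltyP => //; apply: le_lt_trans ioo.
rewrite le_eqVlt; apply/orP; left; apply/eqP.
rewrite [RHS]integral_mkcond; apply: eq_integral => x _.
rewrite (_ : (fun y => _) =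
    fun y => ((EFin \o (fun p => `|f p|)%R \_ (A `*` B)) (x, y))%E); last first.
  apply/funext => y; rewrite /= !patchE.
  by case: ifPn => _; rewrite // normr0.
rewrite (integral_rect2 (fun p => `|f p|)) !patchE; case: ifPn => // _.
by rewrite gee0_abs//; exact: integral_ge0.
Qed.

Lemma integrable_section_integral f :
  (m1 \x m2)%E.-integrable setT (EFin \o f \_ (A `*` B)) ->
  m1.-integrable A (fun x => \int[m2]_(y in B) (f (x, y))%:E)%E.
Proof.
move=> ifr; apply/integrable_mkcond => //.
have := integrable_fubini_F ifr; rewrite /fubini_F.
by under eq_fun do rewrite integral_rect2.
Qed.

Lemma fubini_rectangle f :
  (m1 \x m2)%E.-integrable setT (EFin \o f \_ (A `*` B)) ->
  (\int[m1]_(x in A) \int[m2]_(y in B) (f (x, y))%:E =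
   \int[m2]_(y in B) \int[m1]_(x in A) (f (x, y))%:E)%E.
Proof.
move=> ifr; have := Fubini ifr.
under eq_integral do rewrite integral_rect2.
rewrite -integral_mkcond => ->.
under eq_integral do rewrite integral_rect1.
by rewrite -integral_mkcond.
Qed.

Lemma ae_integrable_section f :
  (m1 \x m2)%E.-integrable setT (EFin \o f \_ (A `*` B)) ->
  {ae m1, forall x, A x -> m2.-integrable B (fun y => (f (x, y))%:E)}.
Proof.
move=> /ae_integrable1; apply: filterS => x ix Ax.
apply/integrable_mkcond => //.
apply: eq_integrable ix => // y _ /=; rewrite !patchE.
case: ifPn => [/set_mem[_ By]|/negP nAB]; first by rewrite mem_set.
by rewrite memNset// => By; apply: nAB; exact/mem_set.
Qed.

End product_rectangle.

(** * Null sets and integrals that ignore them *)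

Section null_sections.
Context d1 d2 (T1 : measurableType d1) (T2 : measurableType d2) {R : realType}.
Context (m1 : {sigma_finite_measure set T1 -> \bar R})
  (m2 : {sigma_finite_measure set T2 -> \bar R}).

(** By Tonelli the integral of x |-> m2 (xsection S x) equals that of the vanishing y |-> m1
    (ysection S y), and a nonnegative function with integral 0 vanishes almost everywhere. *)
Lemma ae_null_xsection (S : set (T1 * T2)) : measurable S ->
  (forall y, m1 (ysection S y) = 0%E) -> {ae m1, forall x, m2 (xsection S x) = 0%E}.
Proof.
move=> mS S0.
have := indic_fubini_tonelli m1 m2 mS.
rewrite indic_fubini_tonelli_FE// indic_fubini_tonelli_GE//.
rewrite [RHS]integral0_eq => [I0|y _]; last exact: S0.
have mF : measurable_fun setT (m2 \o xsection S) by exact: measurable_fun_xsection.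
have := (ae_eq_integral_abs m1 measurableT mF).1.
under eq_integral do rewrite gee0_abs//.
by move=> /(_ I0); apply: filterS => x /(_ I).
Qed.

End null_sections.

Section conull_integral.
Context d (T : measurableType d) {R : realType}.
Context (mu : {measure set T -> \bar R}) (B : set T) (mB : measurable B).
Context (B0 : mu (~` B) = 0%E).

Lemma integral_conull (f : T -> \bar R) : measurable_fun setT f ->
  (\int[mu]_x f x = \int[mu]_(x in B) f x)%E.
Proof.
move=> mf.
have ge0 (h : T -> \bar R) : measurable_fun setT h -> (forall x, 0 <= h x)%E ->
    (\int[mu]_x h x = \int[mu]_(x in B) h x)%E.
  move=> mh h0; rewrite (@ge0_negligible_integral _ _ _ mu setT (~` B))//.
    by rewrite setTD setCK.
  exact: measurableC.
rewrite integralE [RHS]integralE !ge0//.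
- exact: measurable_funeneg.
- exact: measurable_funepos.
Qed.

End conull_integral.

Section interval_exhaustion.
Context {R : realType} (I : set R) (hI : is_interval I).
Notation leb := (@completed_lebesgue_measure R).

Let negligible_unique (N : set R) : (forall s t, N s -> N t -> s = t) ->
  leb.-negligible N.
Proof.
move=> N1; have [[t Nt]|N0] := pselect (exists t, N t).
  exists [set t]; split; last by move=> s Ns; exact: N1.
    by apply: measurable_lebesgue_line; exact: measurable_set1.
  exact: lebesgue_line_set1.
by apply: negligibleS (negligible_set0 _) => t Nt; apply: N0; exists t.
Qed.

(* Segments with rational end points exhaust I up to its end points. *)
Lemma ae_time_segments (P : I -> Prop) :
  (forall a b : R, I a -> I b -> a <= b ->
    {ae leb, forall t : R, `[a, b]%classic t -> forall It : I t,
       P (exist (fun x => x \in I) t (mem_set It))}) ->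
  ae_time P.
Proof.
move=> h; pose N : set R := val @` [set t : I | ~ P t].
pose seg (pq : rat * rat) : set R :=
  [set t | [/\ N t, I (ratr pq.1), I (ratr pq.2) & ratr pq.1 <= t <= ratr pq.2]].
pose F k : set R := if unpickle k is Some pq then seg pq else set0.
have nF k : leb.-negligible (F k).
  rewrite /F; case: (unpickle k) => [[p q]|]; last exact: negligible_set0.
  have [[Ip Iq pq]|npq] := pselect [/\ I (ratr p), I (ratr q) & ratr p <= ratr q :> R].
    apply: negligibleS (h _ _ Ip Iq pq) => t [[t' nP <-] _ _ /= tpq] /=.
    move=> /(_ _ (set_mem (valP t'))); rewrite in_itv/= => /(_ tpq); apply: contra_not nP.
    congr P; exact: val_inj.
  apply: negligibleS (negligible_set0 _) => t [_ Ip Iq /= /andP[pt tq]].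
  by apply: npq; split => //; exact: le_trans tq.
have nmin : leb.-negligible [set t | I t /\ forall s, I s -> t <= s].
  by apply: negligible_unique => s t [Is hs] [It ht]; apply/eqP; rewrite eq_le hs// ht.
have nmax : leb.-negligible [set t | I t /\ forall s, I s -> s <= t].
  by apply: negligible_unique => s t [Is hs] [It ht]; apply/eqP; rewrite eq_le hs// ht.
apply: negligibleS (negligibleU (negligible_bigcup nF) (negligibleU nmin nmax)).
move=> t Nt; have It : I t by case: Nt => t' _ <-; exact: (set_mem (valP t')).
have [tmin|] := pselect (forall s, I s -> t <= s); first by right; left.
have [tmax _|] := pselect (forall s, I s -> s <= t); first by right; right.
move=> /existsNP[b /not_implyP[Ib /negP]]; rewrite -ltNge => tb.
move=> /existsNP[a /not_implyP[Ia /negP]]; rewrite -ltNge => at_.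
have [p] := rat_in_itvoo at_; rewrite in_itv/= => /andP[ap pt].
have [q] := rat_in_itvoo tb; rewrite in_itv/= => /andP[tq qb].
left; apply: (ex_intro2 _ _ (pickle (p, q)) Logic.I); rewrite /F pickleK.
split; [exact: Nt|by apply: (hI Ia It); rewrite !ltW|
  by apply: (hI It Ib); rewrite !ltW|by rewrite /= !ltW].
Qed.

End interval_exhaustion.

(** * The equation along a single trajectory *)

Section dual_linear_combination.
Context {R : realType} {Y : topologicalLmodType R}.

Lemma dual_sum (w : dual Y) k (c : 'I_k -> R) (v : 'I_k -> Y) :
  w (\sum_j c j *: v j) = \sum_j c j * w (v j).
Proof.
have w0 : w 0 = 0.
  have := dual_linear w 1 0 0; rewrite !scale1r addr0 => /eqP.
  by rewrite -subr_eq0 opprD addrA subrr sub0r oppr_eq0 => /eqP.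
elim/big_rec2 : _ => // j x y _ <-.
exact: dual_linear.
Qed.

End dual_linear_combination.

Section pathwise.
Context {R : realType} {Y : topologicalLmodType R} {X Z : ptopologicalType}.
Context (iZX : Z -> X) (iXY : X -> dual Y).
Context (iXY_cont : continuous (iXY : X -> weakstar_dual Y)).
Context (I : set R) (hI : is_interval I) (F : R -> Z -> dual Y).
Notation leb := (@completed_lebesgue_measure R).

Lemma pairing_continuous (v : Y) : continuous (fun x => iXY x v).
Proof.
move=> x; exact: (@continuous_comp _ (weakstar_dual Y) R iXY (fun w => w v) x
  (@iXY_cont x) (@weakstar_dual_eval_continuous _ _ v _)).
Qed.

Lemma traj_continuous (u : traj I X) : continuous (traj_fun u).
Proof. exact: cts_fun. Qed.

Lemma cyl_coord_continuous (Phi : cylindrical Y) :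
  continuous (fun x => cyl_coord Phi (iXY x)).
Proof.
move=> x; apply/cvg_ballP => e e0.
have : \forall y \near x, forall j, ball (iXY x (@cyl_vec _ _ Phi j)) e (iXY y (cyl_vec j)).
  apply: (@filter_forall _ _ (fun j => [set y | ball (iXY x (@cyl_vec _ _ Phi j)) e
    (iXY y (cyl_vec j))]) (nbhs x) _) => j.
  by have /cvg_ballP /(_ _ e0) := @pairing_continuous (@cyl_vec _ _ Phi j) x.
by apply: filterS => y h; split => // i j; rewrite !mxE.
Qed.

Lemma segment_sub_interval (a b : I) : `[val a, val b] `<=` I.
Proof.
move=> t; rewrite /= in_itv/= => tab.
exact: (hI (set_mem (valP a)) (set_mem (valP b))).
Qed.

(** By linearity the direction that moves with [x] is traded for the fixed vectors [cyl_vec j], to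
    which the hypotheses on [F] apply. *)
Lemma vfield_cyl_diff (Phi : cylindrical Y) (t : I) (x : X) :
  vfield iZX F t x (cyl_diff Phi (iXY x)) =
  \sum_j partial_derivative (@cyl_profile _ _ Phi) j (cyl_coord Phi (iXY x)) *
    vfield iZX F t x (cyl_vec j).
Proof. exact: dual_sum. Qed.

Context (u : traj I X).
Context (FL1loc : scalarwise_L1loc (fun t => vfield iZX F t (u t))).
Context (Feq : forall v : Y, distributional_derivative (fun t => iXY (u t) v)
      (fun t => vfield iZX F t (u t) v)).

Let pairing (v : Y) : R -> R := 'valL_ 0 (fun t : I => iXY (u t) v).
Let field (v : Y) : R -> R := 'valL_ 0 (fun t : I => vfield iZX F t (u t) v).

Let field_integrable (a b : I) v : leb.-integrable `[val a, val b] (EFin \o field v).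
Proof.
rewrite -(valL_comp EFin).
exact: (FL1loc v (@segment_compact _ (val a) (val b)) (@segment_sub_interval a b)).
Qed.

Let pairing_within v (A : set R) : A `<=` I -> {within A, continuous (pairing v)}.
Proof.
move=> AI; apply: (continuous_subspaceW AI); apply/subspace_valL_continuousP'.
move=> t; apply: (@continuous_comp I X R (traj_fun u) (fun x => iXY x v) t).
  exact: traj_continuous.
exact: pairing_continuous.
Qed.

Lemma pathwise_chain_rule (Phi : cylindrical Y) (a b : I) : val a <= val b ->
  cyl_fun Phi (iXY (u b)) - cyl_fun Phi (iXY (u a)) =
  \int[leb]_(t in `[val a, val b])
    'valL_ 0 (fun t : I => vfield iZX F t (u t) (cyl_diff Phi (iXY (u t)))) t.
Proof.
move=> ab; pose f t : 'rV[R]_(cyl_dim Phi) := \row_j pairing (cyl_vec j) t.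
pose g (j : 'I_(cyl_dim Phi)) := field (cyl_vec j).
have fE (t : I) : f (val t) = cyl_coord Phi (iXY (u t)).
  by apply/rowP => j; rewrite !mxE /pairing valL_val.
have cf j : {within `[val a, val b], continuous (fun t => f t 0 j)}.
  rewrite (_ : (fun t => f t 0 j) = pairing (cyl_vec j)); last first.
    by apply/funext => t; rewrite mxE.
  by apply: pairing_within; exact: segment_sub_interval.
have fg j r t : val a <= r -> r <= t -> t <= val b ->
    f t 0 j - f r 0 j = \int[leb]_(s in `[r, t]) g j s.
  move=> ar rt tb; rewrite !mxE.
  have sub : `[r, t] `<=` `[val a, val b].
    move=> s /=; rewrite !in_itv/= => /andP[rs st].
    by rewrite (le_trans ar)// (le_trans st).
  have subI : `[r, t] `<=` I by apply: subset_trans sub _; exact: segment_sub_interval.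
  apply: (distributional_ftc rt subI).
  - exact: pairing_within.
  - by apply: integrableS (field_integrable a b _); [exact: segment_lebesgue_line..|].
  - exact: (Feq (cyl_vec j)).
have := chain_rule (cyl_profileC1 Phi) (@cyl_profile_supp _ _ Phi) ab cf
  (fun j => field_integrable a b _) fg.
rewrite !fE /cyl_fun => ->; apply: eq_Rintegral => t /set_mem/segment_sub_interval It.
pose t' : I := exist (fun x => x \in I) t (mem_set It).
rewrite (_ : t = val t')// valL_val vfield_cyl_diff fE.
by apply: eq_bigr => j _; rewrite /g /field valL_val.
Qed.

End pathwise.

(** * Statistical solutions *)

Section trajectory_statistics.
Context {R : realType} {Y : topologicalLmodType R} {X Z : ptopologicalType}.
Context (iZX : Z -> X) (iZX_inj : injective iZX).
Context (iXY : X -> dual Y) (iXY_cont : continuous (iXY : X -> weakstar_dual Y)).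
Context (I : set R) (hI : is_interval I).
Context (rho : probability (borel (traj I X)) R).
Context (V : set (borel (traj I X))) (mV : measurable V) (rhoV : rho V = 1%E).
Context (hB : forall B : set (borel Z),
    measurable B -> measurable (iZX @` B : set (borel X))).
Context (F : R -> Z -> dual Y).
Context (mF : measurable_fun
    (I `*` setT : set (lebesgue_line R * borel Z)%type)
    (fun p => F p.1 p.2 : borel (strong_dual Y))).
Context (Fint : forall v : Y, L1loc (fun t : I =>
    \int[rho]_(u in V) `|(vfield iZX F t (traj_eval t u) v)%:E|)%E).
Notation leb := (@completed_lebesgue_measure R).
Notation field := (@joint_field R Y X Z I iZX F).

Lemma conull_trajectories : rho (~` V) = 0%E.
Proof. by rewrite probability_setC// rhoV subee. Qed.

Let mfield v : measurable_fun setT (field v).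
Proof. exact: measurable_joint_field. Qed.

Let mK (K : set R) : compact K -> measurable (K : set (lebesgue_line R)).
Proof. by move=> cK; apply: measurable_lebesgue_line; exact: compact_measurable. Qed.

Lemma integrable_joint_field (K : set R) v : compact K -> K `<=` I ->
  (leb \x rho)%E.-integrable setT (EFin \o field v \_ (K `*` V)).
Proof.
move=> cK KI; apply: integrable_rectangle => //; first exact: mK.
have := Fint v cK KI; apply: eq_integrable; first exact: mK.
move=> t /set_mem/KI It; pose t' : I := exist (fun x => x \in I) t (mem_set It).
rewrite (_ : t = val t')// valL_val; apply: eq_integral => u _.
by rewrite joint_fieldE.
Qed.

(** Written as a sum over [j] rather than as a pairing with [cyl_diff]: each term is then a bounded
    measurable factor times a [joint_field], for a fixed vector, whose integrability is known. *)
Definition joint_field_diff (Phi : cylindrical Y)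
    (p : lebesgue_line R * borel (traj I X)) : R :=
  \sum_j partial_derivative (@cyl_profile _ _ Phi) j
    (cyl_coord Phi (iXY (@joint_eval R I X p))) * field (cyl_vec j) p.

Lemma joint_field_diffE (Phi : cylindrical Y) (t : I) (u : traj I X) :
  joint_field_diff Phi (val t, u) =
  vfield iZX F t (u t) (cyl_diff Phi (iXY (u t))).
Proof.
rewrite vfield_cyl_diff /joint_field_diff; apply: eq_bigr => j _.
by rewrite joint_evalE joint_fieldE.
Qed.

Lemma partial_derivative_measurable (Phi : cylindrical Y) j :
  measurable_fun setT ((fun x => partial_derivative (@cyl_profile _ _ Phi) j
    (cyl_coord Phi (iXY x))) : borel X -> R).
Proof.
apply: continuous_borel_measurable => x.
apply: (@continuous_comp X _ R (fun x => cyl_coord Phi (iXY x))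
  (partial_derivative (@cyl_profile _ _ Phi) j)).
  exact: cyl_coord_continuous.
by case: (cyl_profileC1 Phi) => _; apply.
Qed.

Let joint_partial_derivative_measurable (Phi : cylindrical Y) j :
  measurable_fun setT (fun p : lebesgue_line R * borel (traj I X) =>
    partial_derivative (@cyl_profile _ _ Phi) j
      (cyl_coord Phi (iXY (@joint_eval R I X p)))).
Proof.
exact: (measurableT_comp (partial_derivative_measurable j)
  (@measurable_joint_eval R I hI X)).
Qed.

Lemma integrable_joint_field_diff (K : set R) (Phi : cylindrical Y) :
  compact K -> K `<=` I ->
  (leb \x rho)%E.-integrable setT (EFin \o joint_field_diff Phi \_ (K `*` V)).
Proof.
move=> cK KI.
have [M hM] := partial_derivative_bounded (cyl_profileC1 Phi) (@cyl_profile_supp _ _ Phi).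
pose c j (p : lebesgue_line R * borel (traj I X)) :=
  partial_derivative (@cyl_profile _ _ Phi) j (cyl_coord Phi (iXY (@joint_eval R I X p))).
have -> : joint_field_diff Phi \_ (K `*` V) =
    fun p => \sum_j c j p * (field (@cyl_vec _ _ Phi j) \_ (K `*` V)) p.
  apply/funext => p; rewrite !patchE; case: ifPn => pKV.
    by apply: eq_bigr => j _; rewrite patchE pKV.
  by rewrite big1// => j _; rewrite patchE (negbTE pKV) mulr0.
apply: integrable_sum_ord => // j.
apply: (@integrable_bounded_mul _ _ _ _ _ _ _ M) => //.
- exact: joint_partial_derivative_measurable.
- by move=> p _; exact: hM.
- exact: integrable_joint_field.
Qed.

Lemma L1loc_cyl_diff (Phi : cylindrical Y) :
  L1loc (fun s : I => \int[rho]_(u in V)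
    (vfield iZX F s (traj_eval s u) (cyl_diff Phi (iXY (traj_eval s u))))%:E)%E.
Proof.
move=> K cK KI.
have := integrable_section_integral (mK cK)
  (integrable_joint_field_diff Phi cK KI).
apply: eq_integrable; first exact: mK.
move=> t /set_mem/KI It; pose t' : I := exist (fun x => x \in I) t (mem_set It).
rewrite (_ : t = val t')// valL_val; apply: eq_integral => u _.
by rewrite joint_field_diffE.
Qed.

Lemma L1loc_vfield (v : Y) : L1loc (fun s : I =>
  \int[rho]_(u in V) (vfield iZX F s (traj_eval s u) v)%:E)%E.
Proof.
move=> K cK KI.
have := integrable_section_integral (mK cK) (integrable_joint_field v cK KI).
apply: eq_integrable; first exact: mK.
move=> t /set_mem/KI It; pose t' : I := exist (fun x => x \in I) t (mem_set It).
rewrite (_ : t = val t')// valL_val; apply: eq_integral => u _.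
by rewrite joint_fieldE.
Qed.

(** Change of variables for the positive and negative parts separately. No integrability enters, so
    the identity is available at every t, including the exceptional times at which the field is not
    integrable. *)
Lemma integral_law (t : I) (f : X -> \bar R) :
  measurable_fun setT (f : borel X -> \bar R) ->
  (\int[distribution rho (traj_eval t)]_x f x =
   \int[rho]_(u in V) f (traj_eval t u))%E.
Proof.
move=> mf.
have mev := @measurable_traj_eval R I X t.
rewrite -(integral_conull mV conull_trajectories); last exact: measurableT_comp mf mev.
rewrite [LHS]integralE [RHS]integralE.
have law (g : X -> \bar R) : measurable_fun setT (g : borel X -> \bar R) ->
    (forall x, 0 <= g x)%E ->
    (\int[distribution rho (traj_eval t)]_x g x = \int[rho]_u g (traj_eval t u))%E.
  move=> mg g0.
  have h := @ge0_integral_pushforward _ _ _ _ _ _ mev rho setT g measurableT mg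
    (fun x _ => g0 x).
  exact: (etrans _ h).
congr (_ - _)%E.
  rewrite (law (f^\+)%E (measurable_funepos mf) (funepos_ge0 f)).
  by apply: eq_integral => u _; rewrite !funeposE.
rewrite (law (f^\-)%E (measurable_funeneg mf) (funeneg_ge0 f)).
by apply: eq_integral => u _; rewrite !funenegE.
Qed.

Lemma integrable_law (t : I) (f : X -> \bar R) :
  measurable_fun setT (f : borel X -> \bar R) ->
  rho.-integrable V (fun u => f (traj_eval t u)) ->
  (distribution rho (traj_eval t) : measure _ _).-integrable setT f.
Proof.
move=> mf /integrableP[_ fi]; apply/integrableP; split => //.
by rewrite integral_law//; exact: measurableT_comp.
Qed.

Lemma profile_bounded (Phi : cylindrical Y) :
  exists M : R, forall x, `|@cyl_profile _ _ Phi x| <= M.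
Proof.
have [dphi _] := cyl_profileC1 Phi.
have := @cyl_profile_supp _ _ Phi; rewrite /compactly_supported.
set S := closure _ => cS.
have cimg : compact (@cyl_profile _ _ Phi @` S).
  apply: continuous_compact => //; apply: continuous_subspaceT => x.
  exact: differentiable_continuous.
have [M [_ /(_ (M + 1)) h]] := compact_bounded cimg.
exists `|M + 1| => x.
have [x0|x0] := eqVneq (cyl_profile x) 0; first by rewrite x0 normr0.
apply: le_trans (ler_norm _); apply: h; first by rewrite ltrDl.
by exists x => //; exact: subset_closure.
Qed.

Lemma cyl_fun_continuous (Phi : cylindrical Y) :
  continuous (fun x => cyl_fun Phi (iXY x)).
Proof.
move=> x; apply: (@continuous_comp X _ R (fun x => cyl_coord Phi (iXY x))
  (@cyl_profile _ _ Phi)); first exact: cyl_coord_continuous.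
by apply: differentiable_continuous; case: (cyl_profileC1 Phi).
Qed.

Lemma integrable_bounded_observable (phi : X -> R) (M : R) (t : I) :
  continuous phi -> (forall x, `|phi x| <= M) ->
  rho.-integrable V (fun u => (phi (traj_eval t u))%:E).
Proof.
move=> cphi hM.
have i1 : rho.-integrable V (EFin \o cst (1 : R)).
  exact: finite_measure_integrable_cst.
have mp : measurable_fun V (fun u => phi (traj_eval t u)).
  apply: measurable_funTS.
  exact: (measurableT_comp (continuous_borel_measurable cphi) (@measurable_traj_eval R I X t)).
have := integrable_bounded_mul mV mp (fun u _ => hM (traj_eval t u)) i1.
by apply: eq_integrable => // u _ /=; rewrite mulr1.
Qed.

Lemma integrable_cyl_fun (Phi : cylindrical Y) (t : I) :
  rho.-integrable V (fun u => (cyl_fun Phi (iXY (traj_eval t u)))%:E).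
Proof.
have [M hM] := profile_bounded Phi.
apply: (@integrable_bounded_observable (fun x => cyl_fun Phi (iXY x)) M t).
  exact: cyl_fun_continuous.
by move=> x; exact: hM.
Qed.

(** A failure of continuity at [t] would give times [s n] within 1/(n+1) of [t] whose means stay [e]
    away from the mean at [t]. Along this sequence dominated convergence applies, trajectories being
    continuous and [phi] bounded. *)
Lemma continuous_observable (phi : X -> R) : continuous phi -> bounded_fun phi ->
  continuous (fun t : I => \int[rho]_(u in V) phi (traj_eval t u)).
Proof.
move=> cphi [M0 [_ hM0]]; pose M := M0 + 1.
have hM x : `|phi x| <= M by apply: hM0 => //; rewrite ltrDl.
move=> t; pose g (s : I) := \int[rho]_(u in V) phi (traj_eval s u).
apply/(@cvgrPdist_lt _ _ _ _ (@nbhs_filter I t)) => e e0.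
suff [d d0 hd] : exists2 d : R, 0 < d &
    forall s : I, `|val t - val s| < d -> `|g t - g s| < e.
  have vt : (val : I -> R) @ t --> val t by exact: initial_continuous.
  exact: (@filterS _ (nbhs t) (@nbhs_filter I t) _ _ hd (vt _ (nbhsx_ballx (val t) d d0))).
apply: contrapT => nd.
have bad n : exists s : I, `|val t - val s| < n.+1%:R^-1 /\ ~ `|g t - g s| < e.
  apply: contrapT => /forallNP h; apply: nd; exists n.+1%:R^-1; first by [].
  by move=> s ts; apply: contrapT => gs; apply: (h s).
have [s hs] := choice bad.
have st : s n @[n --> \oo] --> t.
  move=> W [_ [[B oB <-] Bt BW]].
  have /nbhs_ballP[d /= d0 dB] : nbhs (val t) B by exact: open_nbhs_nbhs.
  suff : \forall n \near \oo, W (s n) by [].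
  near=> n; apply: BW; apply: dB; rewrite /ball/=.
  apply: (lt_trans (hs n).1); near: n.
  exact: near_infty_natSinv_lt (PosNum d0).
have cv : (\int[rho]_(u in V) (phi (traj_eval (s n) u))%:E)%E @[n --> \oo] -->
    (\int[rho]_(u in V) (phi (traj_eval t u))%:E)%E.
  apply: (@dominated_cvg _ _ _ rho V mV _ _ (fun _ => M%:E)) => //.
  - by move=> n; exact: measurable_int (integrable_bounded_observable (s n) cphi hM).
  - move=> u _; apply: cvg_EFin; first exact: nearW.
    exact: (cvg_comp _ _ st (@continuous_comp I X R (traj_fun u) phi t
      (@traj_continuous _ _ _ u t) (@cphi _))).
  - exact: finite_measure_integrable_cst.
  - by move=> n u _; rewrite lee_fin.
have gcv : g (s n) @[n --> \oo] --> g t.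
  apply: fine_cvg; rewrite fineK//.
  exact: (integrable_fin_num mV (integrable_bounded_observable t cphi hM)).
have /cvgrPdist_lt /(_ e e0) [n _ /(_ n (leqnn n))] := gcv.
exact: (hs n).2.
Unshelve. all: by end_near. Qed.

Context (FL1loc : forall u : traj I X, V u ->
    scalarwise_L1loc (fun t => vfield iZX F t (u t))).
Context (Feq : forall u : traj I X, V u -> forall v : Y,
    distributional_derivative (fun t => iXY (u t) v)
      (fun t => vfield iZX F t (u t) v)).

Lemma integrable_trajectory_diff (Phi : cylindrical Y) (K : set R) (u : traj I X) :
  V u -> compact K -> K `<=` I ->
  leb.-integrable K (fun s => (joint_field_diff Phi (s, u))%:E).
Proof.
move=> Vu cK KI.
have [M hM] := partial_derivative_bounded (cyl_profileC1 Phi) (@cyl_profile_supp _ _ Phi).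
apply: (@integrable_sum_ord _ _ _ _ _ _ (fun j s =>
  partial_derivative (@cyl_profile _ _ Phi) j
    (cyl_coord Phi (iXY (@joint_eval R I X (s, u)))) * field (cyl_vec j) (s, u))).
  exact: mK.
move=> j; apply: (@integrable_bounded_mul _ _ _ _ _ _ _ M).
- exact: mK.
- apply: measurable_funTS.
  exact: (measurable_fun_pair1 (u : borel (traj I X))
    (@joint_partial_derivative_measurable Phi j)).
- by move=> s _; exact: hM.
- have := FL1loc Vu (@cyl_vec _ _ Phi j) cK KI; apply: eq_integrable; first exact: mK.
  by move=> s _; rewrite (valL_comp EFin).
Qed.

Lemma cyl_balance (Phi : cylindrical Y) (a b : I) : val a <= val b ->
  (\int[rho]_(u in V) (cyl_fun Phi (iXY (traj_eval b u)))%:E -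
   \int[rho]_(u in V) (cyl_fun Phi (iXY (traj_eval a u)))%:E =
   \int[leb]_(s in `[val a, val b]) 'valL_ 0 (fun s : I => \int[rho]_(u in V)
    (vfield iZX F s (traj_eval s u) (cyl_diff Phi (iXY (traj_eval s u))))%:E) s)%E.
Proof.
move=> ab; have cK := @segment_compact R (val a) (val b).
have KI := @segment_sub_interval R I hI a b.
rewrite -integralB//; [|exact: integrable_cyl_fun|exact: integrable_cyl_fun].
transitivity (\int[rho]_(u in V) \int[leb]_(s in `[val a, val b])
    (joint_field_diff Phi (s, u))%:E)%E.
  apply: eq_integral => u /set_mem Vu.
  have iJ := integrable_trajectory_diff Phi Vu cK KI.
  rewrite -EFinB.
  have := pathwise_chain_rule iXY_cont hI (FL1loc Vu) (Feq Vu) Phi ab.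
  rewrite /traj_eval => ->; rewrite /Rintegral.
  rewrite [in LHS](@eq_integral _ _ _ leb _ (fun s => (joint_field_diff Phi (s, u))%:E)).
    by rewrite fineK//; exact: (integrable_fin_num (segment_lebesgue_line _ _) iJ).
  move=> s /set_mem/KI Is; pose s' : I := exist (fun x => x \in I) s (mem_set Is).
  by rewrite (_ : s = val s')// valL_val joint_field_diffE.
rewrite -(fubini_rectangle (integrable_joint_field_diff Phi cK KI)).
apply: eq_integral => s /set_mem/KI Is; pose s' : I := exist (fun x => x \in I) s (mem_set Is).
rewrite (_ : s = val s')// valL_val; apply: eq_integral => u _.
by rewrite joint_field_diffE.
Qed.

Lemma cyl_identity (Phi : cylindrical Y) (t t' : I) :
  (\int[rho]_(u in V) (cyl_fun Phi (iXY (traj_eval t u)))%:E =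
   \int[rho]_(u in V) (cyl_fun Phi (iXY (traj_eval t' u)))%:E +
   oriented_integral t' t (fun s : I => \int[rho]_(u in V)
    (vfield iZX F s (traj_eval s u) (cyl_diff Phi (iXY (traj_eval s u))))%:E))%E.
Proof.
(* Finiteness of the means allows the differences of extended reals to be undone, in either
   orientation of time. *)
have fin s := integrable_fin_num mV (integrable_cyl_fun Phi s).
rewrite /oriented_integral; case: leP => [tt'|/ltW tt'].
  by rewrite -(cyl_balance Phi tt') addeC subeK.
by rewrite -(cyl_balance Phi tt') fin_num_oppeB// addeA subee// add0e.
Qed.

(** [F (val t)] is a section of a jointly measurable function, hence measurable for every t in [I],
    without an exceptional set. *)
Lemma measurable_vfield (t : I) (v : Y) :
  measurable_fun setT ((fun x => vfield iZX F t x v) : borel X -> R).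
Proof.
have -> : (fun x => vfield iZX F t x v) =
    (fun x : borel X => F (val t) (left_inverse iZX x) v) \_ (range iZX).
  by apply/funext => x; rewrite /vfield extZE.
apply/(measurable_restrictT _ (measurable_range_inclusion hB)).
apply: measurable_funTS.
have ms : measurable_fun setT (fun z : borel Z => F (val t) z : borel (strong_dual Y)).
  apply: (measurable_comp _ _ mF (pair1_measurable (val t : lebesgue_line R))).
    by apply: measurableX => //; exact: measurable_interval_lebesgue_line.
  by move=> _ [z _ <-]; split => //; exact: (set_mem (valP t)).
apply: (measurableT_comp (measurable_strong_dual_eval v)).
exact: (measurableT_comp ms (measurable_left_inverse iZX_inj hB)).
Qed.

Lemma measurable_vfield_diff (Phi : cylindrical Y) (t : I) :
  measurable_fun setT ((fun x =>
    vfield iZX F t x (cyl_diff Phi (iXY x))) : borel X -> R).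
Proof.
under eq_fun do rewrite vfield_cyl_diff.
apply: measurable_sum => j; apply: measurable_funM; last exact: measurable_vfield.
exact: partial_derivative_measurable.
Qed.

(** Fubini yields integrable sections at almost every time of a compact segment, since integrability
    on the product is local in time; [ae_time_segments] then covers [I]. *)
Lemma ae_integrable_vfield (v : Y) : ae_time (fun t : I =>
  (distribution rho (traj_eval t) : measure _ _).-integrable setT
    (fun x => (vfield iZX F t x v)%:E)).
Proof.
apply: ae_time_segments => // a b Ia Ib ab.
have abI : `[a, b] `<=` I.
  by move=> t; rewrite /= in_itv/=; exact: hI.
have := ae_integrable_section mV (integrable_joint_field v (@segment_compact _ a b) abI).
apply: filterS => t h tab It; apply: integrable_law.
  by apply/measurable_EFinP; exact: measurable_vfield.
have := h tab; apply: eq_integrable => // u _.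
by rewrite -(joint_fieldE iZX F v (exist (fun x => x \in I) t (mem_set It))).
Qed.

Context (ZV : forall u : traj I X, V u -> Zcal iZX u).

(** [S] collects the pairs with u(t) outside Z. Limiting it to trajectories in [V] makes its section
    at every u null: by [ZV] if u is in [V], and because it is empty otherwise. *)
Lemma ae_carried : ae_time (fun t : I =>
  carried_by (distribution rho (traj_eval t)) (range iZX : set (borel X))).
Proof.
have mr := measurable_range_inclusion hB.
have mI := measurable_interval_lebesgue_line hI.
pose S : set (lebesgue_line R * borel (traj I X)) :=
  (I `*` V) `&` @joint_eval R I X @^-1` (~` range iZX).
have mS : measurable S.
  apply: measurableI; first exact: measurableX.
  rewrite -[X in measurable X]setTI.
  by apply: (@measurable_joint_eval R I hI X) => //; exact: measurableC.
have S0 u : leb (ysection S u) = 0%E.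
  apply: measure_negligible; first exact: measurable_ysection.
  have [Vu|nVu] := pselect (V u); last first.
    by apply: negligibleS (negligible_set0 _) => t; rewrite /ysection/= inE => -[[_ /nVu]].
  apply: negligibleS (ZV Vu) => t.
  rewrite /ysection/= inE => -[[It _] /= nr].
  pose t' : I := exist (fun x => x \in I) t (mem_set It).
  by exists t' => //=; rewrite -joint_evalE.
have nS : leb.-negligible (~` [set t | rho (xsection S t) = 0%E]).
  exact: (@ae_null_xsection _ _ _ _ _ _ rho S mS S0).
apply: negligibleS nS => _ [t nP <-] /= xS0; apply: nP.
split => //; apply/eqP; rewrite -measure_le0.
have mE : measurable (traj_eval t @^-1` (~` range iZX) : set (borel (traj I X))).
  rewrite -[X in measurable X]setTI.
  by apply: (@measurable_traj_eval R I X t) => //; exact: measurableC.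
change (rho (traj_eval t @^-1` (~` range iZX)) <= 0)%E.
(* The trajectories outside [V], which [S] leaves out, are added as a null set. *)
have -> : 0%E = (rho (xsection S (val t)) + rho (~` V))%E.
  by rewrite xS0 conull_trajectories adde0.
apply: (le_trans _ (measureU2 _ _ _)).
- apply: le_measure; rewrite ?inE//.
  + by apply: measurableU; [exact: measurable_xsection|exact: measurableC].
  + move=> u nr; have [Vu|] := pselect (V u); last by right.
    left; rewrite /xsection/= inE; split; first by split => //; exact: (set_mem (valP t)).
    by rewrite /preimage/= joint_evalE.
- exact: measurable_xsection.
- exact: measurableC.
Qed.

Lemma ae_carried_integrable (v : Y) : ae_time (fun t : I =>
  carried_by (distribution rho (traj_eval t)) (range iZX : set (borel X)) /\
  (distribution rho (traj_eval t) : measure _ _).-integrable setT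
    (fun x => (vfield iZX F t x v)%:E)).
Proof.
have := negligibleU ae_carried (ae_integrable_vfield v).
by apply: negligibleS => _ [t /not_andP[h|h] <-]; [left|right]; exists t.
Qed.

End trajectory_statistics.

Theorem theorem3p3 (R : realType) (Y : topologicalLmodType R)
  (X Z : ptopologicalType) (hX : hausdorff_space X) (hZ : hausdorff_space Z)
  (iZX : Z -> X) (iZX_inj : injective iZX) (iZX_cont : continuous iZX)
  (iXY : X -> dual Y) (iXY_inj : injective iXY)
  (iXY_cont : continuous (iXY : X -> weakstar_dual Y))
  (I : set R) (hI : is_interval I)
  (U : set (traj I X))
  (rho : probability (borel (traj I X)) R)
  (hrho : trajectory_statistical_solution U rho)
  (V : set (borel (traj I X))) (mV : measurable V) (VU : V `<=` U)
  (rhoV : rho V = 1%E)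
  (hB : forall B : set (borel Z),
    measurable B -> measurable (iZX @` B : set (borel X)))
  (UX1 : U `<=` X1 iZX iXY)
  (F : R -> Z -> dual Y)
  (mF : measurable_fun
    (I `*` setT : set (lebesgue_line R * borel Z)%type)
    (fun p => F p.1 p.2 : borel (strong_dual Y)))
  (FL1loc : forall u : traj I X, U u ->
    scalarwise_L1loc (fun t => vfield iZX F t (u t)))
  (Feq : forall u : traj I X, U u -> forall v : Y,
    distributional_derivative (fun t => iXY (u t) v)
      (fun t => vfield iZX F t (u t) v))
  (Fint : forall v : Y, L1loc (fun t : I =>
    \int[rho]_(u in V) `|(vfield iZX F t (traj_eval t u) v)%:E|)%E) :
  [/\ forall Phi : cylindrical Y,
        L1loc (fun s : I => \int[rho]_(u in V)
          (vfield iZX F s (traj_eval s u)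
             (cyl_diff Phi (iXY (traj_eval s u))))%:E)%E /\
        forall t t' : I,
        (\int[rho]_(u in V) (cyl_fun Phi (iXY (traj_eval t u)))%:E =
         \int[rho]_(u in V) (cyl_fun Phi (iXY (traj_eval t' u)))%:E +
         oriented_integral t' t (fun s : I => \int[rho]_(u in V)
           (vfield iZX F s (traj_eval s u)
              (cyl_diff Phi (iXY (traj_eval s u))))%:E))%E,
      forall phi : X -> R, continuous phi -> bounded_fun phi ->
        continuous (fun t : I => \int[rho]_(u in V) phi (traj_eval t u)) &
      phase_space_statistical_solution iZX iXY F
        (fun t : I => distribution rho (traj_eval t))].
Proof.
have FL1V u : V u -> scalarwise_L1loc (fun t => vfield iZX F t (u t)).
  by move=> /VU; exact: FL1loc.
have FeqV u : V u -> forall v : Y,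
    distributional_derivative (fun t => iXY (u t) v) (fun t => vfield iZX F t (u t) v).
  by move=> /VU; exact: Feq.
have ZV u : V u -> Zcal iZX u by move=> /VU/UX1[].
have L1Phi := L1loc_cyl_diff iZX_inj iXY_cont hI mV hB mF Fint.
have idPhi := cyl_identity iZX_inj iXY_cont hI mV hB mF Fint FL1V FeqV.
have law := integral_law mV rhoV.
have mdiff := measurable_vfield_diff iZX_inj iXY_cont hI hB mF.
(* The equality holds at every time, so the claims on the laws are literally those on [rho],
   including local integrability. *)
have lawdiff Phi : (fun s : I => \int[distribution rho (traj_eval s)]_x
      (vfield iZX F s x (cyl_diff Phi (iXY x)))%:E)%E =
    (fun s : I => \int[rho]_(u in V) (vfield iZX F s (traj_eval s u)
      (cyl_diff Phi (iXY (traj_eval s u))))%:E)%E.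
  by apply/funext => s; apply: law; apply/measurable_EFinP; exact: mdiff.
split.
- by move=> Phi; split; [exact: L1Phi|exact: idPhi].
- by move=> phi cphi bphi; exact: continuous_observable.
- split.
  + move=> phi cphi bphi.
    rewrite [X in continuous X](_ : _ =
        fun t : I => \int[rho]_(u in V) phi (traj_eval t u)).
      exact: continuous_observable.
    apply/funext => t; congr fine; apply: law.
    by apply/measurable_EFinP; exact: continuous_borel_measurable.
  + split=> v; last first.
      rewrite [X in L1loc X](_ : _ = fun t : I => \int[rho]_(u in V)
          (vfield iZX F t (traj_eval t u) v)%:E)%E.
        exact: (L1loc_vfield iZX_inj hI mV hB mF Fint).
      apply/funext => t; apply: law; apply/measurable_EFinP.
      exact: measurable_vfield.
    exact: (ae_carried_integrable iZX_inj hI mV rhoV hB mF Fint ZV).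
  + move=> Phi; rewrite lawdiff; split; first exact: L1Phi.
    have mPhi : measurable_fun setT
        ((fun x => (cyl_fun Phi (iXY x))%:E) : borel X -> \bar R).
      apply/measurable_EFinP.
      exact: (continuous_borel_measurable (cyl_fun_continuous iXY_cont (Phi := Phi))).
    by move=> t t'; rewrite !law//; exact: idPhi.
Qed.
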